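(* Let $P$ be a closed $\mathsf{HO}$ process (of the core fragment) with $\widetilde u=\mathtt{fn}(P)$, and let $\sigma=\{\mathsf{init}(\widetilde u)/\widetilde u\}$. If $\Gamma;\emptyset;\Delta\vdash P\triangleright\diamond$ (typability with standard session types), then $\mathcal G(\Gamma\sigma);\emptyset;\mathcal G(\Delta\sigma)\vdash \mathcal D(P)\triangleright\diamond$ (typability with minimal session types).
   Context: **Processes.** Names $n$ are shared names $a,b,c,\dots$ or session names $s,\overline s$ (disjoint sets); duality satisfies $\overline{\overline s}=s$, $\overline a=a$. Let $u,w$ range over names and variables. Values: $V::=x\mid \lambda x.P$. Core-fragment processes: $P,Q::=u!\langle V\rangle.P\mid u?(x).P\mid V\,u\mid P\mid Q\mid(\nu n)P\mid\mathbf 0$ (output, input, application, parallel composition, restriction, inaction); no labeled choice, no recursive types. $(\nu s)P$ binds $s$ and $\overline s$. $\mathtt{fv},\mathtt{fn}$ are free variables and names; $P$ is closed if $\mathtt{fv}(P)=\emptyset$. Processes are taken up to $\alpha$-conversion. The target language is polyadic: tuples $\widetilde V,\widetilde x,\widetilde u$ may be used in session communications, abstractions $\lambda\widetilde x.P$ and applications $V\,\widetilde u$ (not in communications on shared names). Trailing $\mathbf 0$ may be omitted. $\epsilon$ is the empty tuple. **Types.** $U::=C\rightarrow\diamond\mid C\multimap\diamond$ (shared / linear abstractions); $C::=S\mid\langle U\rangle$ ($\langle U\rangle$: shared channel); $S::=\mathsf{end}\mid\ !\langle U\rangle;S\mid\ ?(U);S$. $\diamond$ is the process type. Duality ($S_1\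 \mathsf{dual}\ S_2$) exchanges $!$ and $?$. Bound names and variables carry type annotations: $(\nu s:C)P$, and $\lambda x:C^{\leadsto}.P$ with $\leadsto\in\{\multimap,\rightarrow\}$ when the abstraction has type $C\leadsto\diamond$. *Minimal session types* (polyadic): $U::=\widetilde C\rightarrow\diamond\mid\widetilde C\multimap\diamond$; $C::=M\mid\langle U\rangle$; $M::=\mathsf{end}\mid\ !\langle\widetilde U\rangle;\mathsf{end}\mid\ ?(\widetilde U);\mathsf{end}$. **Typing.** Environments: $\Gamma$ maps variables to $C\rightarrow\diamond$ and names (or name variables) to $\langle U\rangle$; $\Lambda$ maps variables to $C\multimap\diamond$; $\Delta$ maps names (or name variables) to session types. $\Gamma$ admits weakening, contraction, exchange; $\Lambda,\Delta$ only exchange; domains are pairwise disjoint. Rules (the polyadic ones are the evident tuple versions; tuples are typed componentwise, splitting $\Lambda,\Delta$): - Sess: $\Gamma;\emptyset;u:S\vdash u\triangleright S$. Sh: $\Gamma,u:\langle U\rangle;\emptyset;\emptyset\vdash u\triangleright\langle U\rangle$. LVar: $\Gamma;x:C\multimap\diamond;\emptyset\vdash x\triangleright C\multimap\diamond$. Nil: $\Gamma;\emptyset;\emptyset\vdash\mathbf 0\triangleright\diamond$. - Prom: from $\Gamma;\emptyset;\emptyset\vdash V\triangleright C\multimap\diamond$ infer $\Gamma;\emptyset;\emptyset\vdash V\triangleright C\rightarrow\diamond$. EProm: from $\Gamma;\Lambda,x:C\multimap\diamond;\Delta\vdash P\triangleright\diamond$ infer $\Gamma,x:C\rightarrow\diamond;\Lambda;\Delta\vdash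 P\triangleright\diamond$ (likewise for values). - Abs: from $\Gamma;\Lambda;\Delta_1\vdash P\triangleright\diamond$ and $\Gamma;\emptyset;\Delta_2\vdash x\triangleright C$ infer $\Gamma\setminus x;\Lambda;\Delta_1\setminus\Delta_2\vdash\lambda x.P\triangleright C\multimap\diamond$. App: from $\Gamma;\Lambda;\Delta_1\vdash V\triangleright C\leadsto\diamond$ and $\Gamma;\emptyset;\Delta_2\vdash u\triangleright C$ infer $\Gamma;\Lambda;\Delta_1,\Delta_2\vdash V\,u\triangleright\diamond$. - Send: from $u:S\in\Delta_1,\Delta_2$, $\Gamma;\Lambda_1;\Delta_1\vdash P\triangleright\diamond$, $\Gamma;\Lambda_2;\Delta_2\vdash V\triangleright U$ infer $\Gamma;\Lambda_1,\Lambda_2;((\Delta_1,\Delta_2)\setminus u:S),u:!\langle U\rangle;S\vdash u!\langle V\rangle.P\triangleright\diamond$. - Rcv: from $\Gamma;\Lambda_1;\Delta,u:S\vdash P\triangleright\diamond$ and $\Gamma;\Lambda_2;\emptyset\vdash x\triangleright U$ infer $\Gamma\setminus x;\Lambda_1\setminus\Lambda_2;\Delta,u:?(U);S\vdash u?(x).P\triangleright\diamond$. - Req: from $\Gamma;\emptyset;\emptyset\vdash u\triangleright\langle U\rangle$, $\Gamma;\Lambda;\Delta_1\vdash P\triangleright\diamond$, $\Gamma;\emptyset;\Delta_2\vdash V\triangleright U$ infer $\Gamma;\Lambda;\Delta_1,\Delta_2\vdash u!\langle V\rangle.P\triangleright\diamond$. Acc: from $\Gamma;\emptyset;\emptyset\vdash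 u\triangleright\langle U\rangle$, $\Gamma;\Lambda_1;\Delta\vdash P\triangleright\diamond$, $\Gamma;\Lambda_2;\emptyset\vdash x\triangleright U$ infer $\Gamma\setminus x;\Lambda_1\setminus\Lambda_2;\Delta\vdash u?(x).P\triangleright\diamond$. - Par: from $\Gamma;\Lambda_i;\Delta_i\vdash P_i\triangleright\diamond$ ($i=1,2$) infer $\Gamma;\Lambda_1,\Lambda_2;\Delta_1,\Delta_2\vdash P_1\mid P_2\triangleright\diamond$. End: from $\Gamma;\Lambda;\Delta\vdash P\triangleright\diamond$, $u\notin\mathrm{dom}(\Gamma,\Lambda,\Delta)$ infer $\Gamma;\Lambda;\Delta,u:\mathsf{end}\vdash P\triangleright\diamond$. Res: from $\Gamma,a:\langle U\rangle;\Lambda;\Delta\vdash P\triangleright\diamond$ infer $\Gamma;\Lambda;\Delta\vdash(\nu a)P\triangleright\diamond$. ResS: from $\Gamma;\Lambda;\Delta,s:S_1,\overline s:S_2\vdash P\triangleright\diamond$ with $S_1\ \mathsf{dual}\ S_2$ infer $\Gamma;\Lambda;\Delta\vdash(\nu s)P\triangleright\diamond$. The minimal type system is the same (polyadic) system with all types restricted to minimal ones. **Type decomposition $\mathcal G$** (session types go to lists of minimal session types): $\mathcal G(!\langle U\rangle;S)$ is $!\langle\mathcal G(U)\rangle;\mathsf{end}$ if $S=\mathsf{end}$ and $!\langle\mathcal G(U)\rangle;\mathsf{end},\ \mathcal G(S)$ otherwise; $\mathcal G(?(U);S)$ is $?(\mathcal G(U));\mathsf{end}$ if $S=\mathsf{end}$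 and $?(\mathcal G(U));\mathsf{end},\ \mathcal G(S)$ otherwise; $\mathcal G(\mathsf{end})=\mathsf{end}$; $\mathcal G(C\multimap\diamond)=\mathcal G(C)\multimap\diamond$; $\mathcal G(C\rightarrow\diamond)=\mathcal G(C)\rightarrow\diamond$; $\mathcal G(\langle U\rangle)=\langle\mathcal G(U)\rangle$; $\mathcal G(S_1,\dots,S_n)=\mathcal G(S_1),\dots,\mathcal G(S_n)$. $|\mathcal G(C)|$ is the list length. On environments: $\mathcal G(\emptyset)=\emptyset$; $\mathcal G(\Delta,u_i:S)=\mathcal G(\Delta),(u_i,\dots,u_{i+|\mathcal G(S)|-1}):\mathcal G(S)$; $\mathcal G(\Gamma,u_i:\langle U\rangle)=\mathcal G(\Gamma),u_i:\mathcal G(\langle U\rangle)$; $\mathcal G(\Gamma,x:U)=\mathcal G(\Gamma),x:\mathcal G(U)$; $\mathcal G(\Lambda,x:U)=\mathcal G(\Lambda),x:\mathcal G(U)$. **Indexed names.** $\mathsf{init}(a,b,s,s',\dots)=(a_1,b_1,s_1,s'_1,\dots)$. A process is initialized if all its names carry an index. **Degree.** $|u_i!\langle V\rangle.Q|=|V|+|Q|+1$; $|u_i?(y).Q|=|Q|+1$; $|V\,u_i|=|V|+1$; $|(\nu s:C)P'|=|P'|$; $|Q\mid R|=|Q|+|R|+1$; $|\mathbf 0|=1$; for values $|\lambda x:C^{\multimap}.P|=|P|$, $|\lambda x:C^{\rightarrow}.P|=0$, $|y|=0$. **Breakdown.** Propagators $c_k,c_{k+1},\dots$ are reserved session names. When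 $\widetilde x=\epsilon$, the prefix $c_k?()$ means $c_k?(x)$ and $\overline{c_k}!\langle\rangle$ means $\overline{c_k}!\langle\lambda x.\mathbf 0\rangle$, with types $?(\mathsf{end}\rightarrow\diamond);\mathsf{end}$ and $!\langle\mathsf{end}\rightarrow\diamond\rangle;\mathsf{end}$. For $k>0$ and a tuple of variables $\widetilde x$ (the context; higher-order variables only, name variables being treated as indexed names), using type information: - $\mathcal B_k^{\tilde x}(u_i!\langle V\rangle.Q)=c_k?(\widetilde x).u_i!\langle\mathcal V_{k+1}^{\tilde y}(V\sigma)\rangle.\overline{c_{k+l+1}}!\langle\widetilde z\rangle\mid\mathcal B_{k+l+1}^{\tilde z}(Q\sigma)$, with $\widetilde y=\mathtt{fv}(V)$, $\widetilde z=\mathtt{fv}(Q)$, $l=|V|$, and $\sigma=\{u_{i+1}/u_i\}$ if $u_i$ has a session type, $\sigma=\{\}$ otherwise. - $\mathcal B_k^{\tilde x}(u_i?(y).Q)=c_k?(\widetilde x).u_i?(y).\overline{c_{k+1}}!\langle\widetilde x'\rangle\mid\mathcal B_{k+1}^{\tilde x'}(Q\sigma)$, with $\widetilde x'=\mathtt{fv}(Q)$, $\sigma$ as before. - $\mathcal B_k^{\tilde x}(V\,u_i)=c_k?(\widetilde x).(\mathcal V_{k+1}^{\tilde x}(V)\,\widetilde m)$, with $u_i:C$, $\widetilde x=\mathtt{fv}(V)$, $\widetilde m=(u_i,\dots,u_{i+|\mathcal G(C)|-1})$. - $\mathcal B_k^{\tilde x}((\nu s:C)P')=(\nu\widetilde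 s:\mathcal G(C))\mathcal B_k^{\tilde x}(P'\sigma)$, with $\widetilde x=\mathtt{fv}(P')$, $\widetilde s=(s_1,\dots,s_{|\mathcal G(C)|})$, $\sigma=\{s_1\overline{s_1}/s\overline s\}$ if $C$ is a session type, $\sigma=\{s_1/s\}$ if $C=\langle U\rangle$. - $\mathcal B_k^{\tilde x}(Q\mid R)=c_k?(\widetilde x).\overline{c_{k+1}}!\langle\widetilde y\rangle.\overline{c_{k+l+1}}!\langle\widetilde z\rangle\mid\mathcal B_{k+1}^{\tilde y}(Q)\mid\mathcal B_{k+l+1}^{\tilde z}(R)$, with $\widetilde y=\mathtt{fv}(Q)$, $\widetilde z=\mathtt{fv}(R)$, $l=|Q|$. - $\mathcal B_k^{\tilde x}(\mathbf 0)=c_k?().\mathbf 0$. - $\mathcal V_k^{\tilde x}(y)=y$. - $\mathcal V_k^{\tilde x}(\lambda y:C^{\leadsto}.P)=\lambda\widetilde y:\mathcal G(C)^{\leadsto}.(\nu\widetilde c)(\overline{c_k}!\langle\widetilde x\rangle\mid\mathcal B_k^{\tilde x}(P\{y_1/y\}))$, with $\widetilde x$ the free variables of the abstraction, $\widetilde y=(y_1,\dots,y_{|\mathcal G(C)|})$, $\widetilde c=\epsilon$ if $\leadsto=\multimap$ and $\widetilde c=(c_k,\dots,c_{k+|P|-1})$ if $\leadsto=\rightarrow$. **Decomposition.** For closed $P$ with $\widetilde u=\mathtt{fn}(P)$: $\mathcal D(P)=(\nu\widetilde c)(\overline{c_k}!\langle\rangle.\mathbf 0\mid\mathcal B_k^{\epsilon}(P\sigma))$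 with $k>0$, $\widetilde c=(c_k,\dots,c_{k+|P|-1})$, $\sigma=\{\mathsf{init}(\widetilde u)/\widetilde u\}$.
   Formalization: Added hypothesis: in P no value is applied to a session channel that has already communicated and reached type end; otherwise D(P) mentions a name u_{i+1} with no slot in G(Δσ), e.g. s!⟨λy.0⟩.((λz.0) s) with s:!⟨end⊸⋄⟩;end, and the claim fails. *)

(* Defs.v *)
(* Terms are raw named terms, to be read modulo alpha-conversion.  No
   substitution below can capture: the only substitutions are renamings of a
   plain identifier to an indexed one, or of an index to the next one, and
   source binders are never indexed. *)
From Stdlib Require Import List Permutation Arith Bool.
Import ListNotations.

Set Implicit Arguments.

Inductive mode := Lin | Shr.

(* [Fun Lin C] is C -o <>, [Fun Shr C] is C -> <>. *)
Inductive utype := Fun (m : mode) (C : ctype)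
with ctype := CSes (S : stype) | CShr (U : utype)
with stype := SEnd | SOut (U : utype) (S : stype) | SIn (U : utype) (S : stype).

Fixpoint dual (S : stype) : stype :=
  match S with
  | SEnd => SEnd
  | SOut U S' => SIn U (dual S')
  | SIn U S' => SOut U (dual S')
  end.

(* [ISes s false] is the endpoint s, [ISes s true] is its dual. *)
Inductive ident := IShr (a : nat) | ISes (s : nat) (co : bool) | IVar (x : nat).

Lemma ident_eq_dec (u v : ident) : {u = v} + {u <> v}.
Proof. decide equality; solve [apply Nat.eq_dec | apply bool_dec]. Defined.

(* A variable occurs either as a value, [Var x], or as a channel, [IVar x]. *)
Inductive proc :=
| Send (u : ident) (V : val) (P : proc)
| Recv (u : ident) (x : nat) (P : proc)
| App (V : val) (u : ident)
| Par (P Q : proc)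
| ResShr (a : nat) (U : utype) (P : proc)
| ResSes (s : nat) (S : stype) (P : proc)
| Nil
with val :=
| Var (x : nat)
| Abs (m : mode) (x : nat) (C : ctype) (P : proc).

Fixpoint free (P : proc) : list ident :=
  match P with
  | Send u V Q => u :: freeV V ++ free Q
  | Recv u x Q => u :: remove ident_eq_dec (IVar x) (free Q)
  | App V u => freeV V ++ [u]
  | Par Q R => free Q ++ free R
  | ResShr a _ Q => remove ident_eq_dec (IShr a) (free Q)
  | ResSes s _ Q =>
      remove ident_eq_dec (ISes s false)
        (remove ident_eq_dec (ISes s true) (free Q))
  | Nil => []
  end
with freeV (V : val) : list ident :=
  match V with
  | Var x => [IVar x]
  | Abs _ x _ Q => remove ident_eq_dec (IVar x) (free Q)
  end.

Definition is_name (u : ident) : bool :=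
  match u with IVar _ => false | _ => true end.

Definition fn (P : proc) : list ident := filter is_name (free P).

Definition closed (P : proc) : Prop := forall x, ~ In (IVar x) (free P).

(* An entry of Gamma: x : C -> <> or u : <U>.  The types of identifiers and of
   types are parameters, since the same format serves Gamma (plain names,
   session types), Gamma sigma (indexed names, session types) and
   G(Gamma sigma) (indexed names, minimal session types). *)
Inductive gentry (I X CT UT : Type) := GFun (x : X) (C : CT) | GChan (u : I) (U : UT).
Arguments GFun {I X CT UT} x C.
Arguments GChan {I X CT UT} u U.

Definition genv := list (gentry ident nat ctype utype).
Definition lenv := list (nat * ctype).
Definition senv := list (ident * stype).

Definition gkey (g : gentry ident nat ctype utype) : ident :=
  match g with GFun x _ => IVar x | GChan u _ => u end.

(* The domains are pairwise disjoint (and each environment is functional). *)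
Definition wf (G : genv) (L : lenv) (D : senv) : Prop :=
  NoDup (map gkey G ++ map (fun e => IVar (fst e)) L ++ map fst D).

Definition gminus (G : genv) (x : nat) : genv :=
  filter (fun g => if ident_eq_dec (gkey g) (IVar x) then false else true) G.

(* The annotation of an abstraction is the type at which it is used. *)
Definition ann_ok (V : val) (U : utype) : Prop :=
  match V with Var _ => True | Abs m _ C _ => U = Fun m C end.

(* G; {}; D |- u |> C *)
Inductive has_chan : genv -> senv -> ident -> ctype -> Prop :=
| T_Sess G u S : wf G [] [(u, S)] -> has_chan G [(u, S)] u (CSes S)
| T_Sh G u U : wf G [] [] -> In (GChan u U) G -> has_chan G [] u (CShr U).

(* Differences of linear environments such as D1 \ D2 are read with D2
   contained in D1.  [T_Struct] is weakening, contraction and exchange for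
   Gamma, and exchange for Lambda and Delta.  Since weakening is a rule, an
   entry of Gamma that is shadowed by a binder can be dropped below it, so
   that shadowing in a raw term does not obstruct typing. *)
Inductive has_val : genv -> lenv -> senv -> val -> utype -> Prop :=
| T_LVar G x C : wf G [(x, C)] [] -> has_val G [(x, C)] [] (Var x) (Fun Lin C)
| T_Prom G V C :
    has_val G [] [] V (Fun Lin C) -> has_val G [] [] V (Fun Shr C)
| T_EPromV G L D x C V U :
    has_val G ((x, C) :: L) D V U -> has_val (GFun x C :: G) L D V U
| T_Abs G L D D2 m x C P :
    has_proc G L (D ++ D2) P ->
    has_chan G D2 (IVar x) C ->
    has_val (gminus G x) L D (Abs m x C P) (Fun Lin C)
| T_StructV G G' L L' D D' V U :
    has_val G L D V U ->
    incl G G' -> Permutation L L' -> Permutation D D' -> wf G' L' D' ->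
    has_val G' L' D' V U

with has_proc : genv -> lenv -> senv -> proc -> Prop :=
| T_Nil G : wf G [] [] -> has_proc G [] [] Nil
| T_EProm G L D x C P :
    has_proc G ((x, C) :: L) D P -> has_proc (GFun x C :: G) L D P
| T_App G L D1 D2 V u m C :
    has_val G L D1 V (Fun m C) -> ann_ok V (Fun m C) ->
    has_chan G D2 u C ->
    wf G L (D1 ++ D2) ->
    has_proc G L (D1 ++ D2) (App V u)
| T_Send G L1 L2 D D1 D2 u S U V P :
    Permutation (D1 ++ D2) ((u, S) :: D) ->
    has_proc G L1 D1 P ->
    has_val G L2 D2 V U -> ann_ok V U ->
    wf G (L1 ++ L2) ((u, SOut U S) :: D) ->
    has_proc G (L1 ++ L2) ((u, SOut U S) :: D) (Send u V P)
| T_Rcv G L L2 D u S U x P :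
    has_proc G (L ++ L2) ((u, S) :: D) P ->
    has_val G L2 [] (Var x) U ->
    has_proc (gminus G x) L ((u, SIn U S) :: D) (Recv u x P)
| T_Req G L D1 D2 u U V P :
    has_chan G [] u (CShr U) ->
    has_proc G L D1 P ->
    has_val G [] D2 V U -> ann_ok V U ->
    wf G L (D1 ++ D2) ->
    has_proc G L (D1 ++ D2) (Send u V P)
| T_Acc G L L2 D u U x P :
    has_chan G [] u (CShr U) ->
    has_proc G (L ++ L2) D P ->
    has_val G L2 [] (Var x) U ->
    has_proc (gminus G x) L D (Recv u x P)
| T_Par G L1 L2 D1 D2 P Q :
    has_proc G L1 D1 P -> has_proc G L2 D2 Q ->
    wf G (L1 ++ L2) (D1 ++ D2) ->
    has_proc G (L1 ++ L2) (D1 ++ D2) (Par P Q)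
| T_End G L D u P :
    has_proc G L D P -> wf G L ((u, SEnd) :: D) ->
    has_proc G L ((u, SEnd) :: D) P
| T_Res G L D a U P :
    has_proc (GChan (IShr a) U :: G) L D P -> has_proc G L D (ResShr a U P)
| T_ResS G L D s S1 S2 P :
    has_proc G L ((ISes s false, S1) :: (ISes s true, S2) :: D) P ->
    S2 = dual S1 ->
    has_proc G L D (ResSes s S1 P)
| T_Struct G G' L L' D D' P :
    has_proc G L D P ->
    incl G G' -> Permutation L L' -> Permutation D D' -> wf G' L' D' ->
    has_proc G' L' D' P.

(* [MOut Us] is !<Us>;end and [MIn Us] is ?(Us);end. *)
Inductive mutype := MFun (m : mode) (Cs : list mctype)
with mctype := MCSes (M : mtype) | MCShr (U : mutype)
with mtype := MEnd | MOut (Us : list mutype) | MIn (Us : list mutype).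

Definition mdual (M : mtype) : mtype :=
  match M with MEnd => MEnd | MOut Us => MIn Us | MIn Us => MOut Us end.

(* Index 0 encodes the absence of an index; indices proper start at 1.
   Higher-order variables are never indexed.  Propagators form a separate kind
   of session names, and [VUnit] is the variable x of c?(x) and \x.0 that stand
   for c?() and for the value sent by c!<>; neither can occur in a source
   process. *)
Inductive tses := SIx (s i : nat) | SPg (k : nat).
Inductive tvar := VIx (x i : nat) | VUnit.
Inductive tident := TShr (a i : nat) | TSes (s : tses) (co : bool) | TVar (x : tvar).

Lemma tident_eq_dec (u v : tident) : {u = v} + {u <> v}.
Proof.
decide equality; try solve [apply Nat.eq_dec | apply bool_dec];
  decide equality; apply Nat.eq_dec.
Defined.

(* Restrictions may be left without an annotation, as those of propagators. *)
Inductive mproc :=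
| MSend (u : tident) (Vs : list mval) (P : mproc)
| MRecv (u : tident) (xs : list tvar) (P : mproc)
| MApp (V : mval) (us : list tident)
| MPar (P Q : mproc)
| MResShr (a i : nat) (U : mutype) (P : mproc)
| MResSes (s : tses) (ann : option mtype) (P : mproc)
| MNil
with mval :=
| MVar (x : tvar)
| MAbs (m : mode) (xs : list (tvar * mctype)) (P : mproc).

Definition mgenv := list (gentry tident tvar (list mctype) mutype).
Definition mlenv := list (tvar * list mctype).
Definition msenv := list (tident * mtype).

Definition mgkey (g : gentry tident tvar (list mctype) mutype) : tident :=
  match g with GFun x _ => TVar x | GChan u _ => u end.

Definition mwf (G : mgenv) (L : mlenv) (D : msenv) : Prop :=
  NoDup (map mgkey G ++ map (fun e => TVar (fst e)) L ++ map fst D).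

Definition mgminus (G : mgenv) (xs : list tvar) : mgenv :=
  filter (fun g => if in_dec tident_eq_dec (mgkey g) (map TVar xs)
                   then false else true) G.

Definition mann_ok (V : mval) (U : mutype) : Prop :=
  match V with MVar _ => True | MAbs m xs _ => U = MFun m (map snd xs) end.

Inductive mhas_chan : mgenv -> msenv -> tident -> mctype -> Prop :=
| M_Sess G u M : mwf G [] [(u, M)] -> mhas_chan G [(u, M)] u (MCSes M)
| M_Sh G u U : mwf G [] [] -> In (GChan u U) G -> mhas_chan G [] u (MCShr U).

Inductive mhas_chans : mgenv -> msenv -> list tident -> list mctype -> Prop :=
| M_ChansNil G : mwf G [] [] -> mhas_chans G [] [] []
| M_ChansCons G D1 D2 u us C Cs :
    mhas_chan G D1 u C -> mhas_chans G D2 us Cs ->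
    mwf G [] (D1 ++ D2) ->
    mhas_chans G (D1 ++ D2) (u :: us) (C :: Cs).

Inductive mhas_val : mgenv -> mlenv -> msenv -> mval -> mutype -> Prop :=
| M_LVar G x Cs : mwf G [(x, Cs)] [] -> mhas_val G [(x, Cs)] [] (MVar x) (MFun Lin Cs)
| M_Prom G V Cs :
    mhas_val G [] [] V (MFun Lin Cs) -> mhas_val G [] [] V (MFun Shr Cs)
| M_EPromV G L D x Cs V U :
    mhas_val G ((x, Cs) :: L) D V U -> mhas_val (GFun x Cs :: G) L D V U
| M_Abs G L D D2 m xs P :
    NoDup (map fst xs) ->
    mhas_proc G L (D ++ D2) P ->
    mhas_chans G D2 (map (fun e => TVar (fst e)) xs) (map snd xs) ->
    mhas_val (mgminus G (map fst xs)) L D (MAbs m xs P) (MFun Lin (map snd xs))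
| M_StructV G G' L L' D D' V U :
    mhas_val G L D V U ->
    incl G G' -> Permutation L L' -> Permutation D D' -> mwf G' L' D' ->
    mhas_val G' L' D' V U

with mhas_vals : mgenv -> mlenv -> msenv -> list mval -> list mutype -> Prop :=
| M_ValsNil G : mwf G [] [] -> mhas_vals G [] [] [] []
| M_ValsCons G L1 L2 D1 D2 V Vs U Us :
    mhas_val G L1 D1 V U -> mhas_vals G L2 D2 Vs Us ->
    mwf G (L1 ++ L2) (D1 ++ D2) ->
    mhas_vals G (L1 ++ L2) (D1 ++ D2) (V :: Vs) (U :: Us)

with mhas_proc : mgenv -> mlenv -> msenv -> mproc -> Prop :=
| M_Nil G : mwf G [] [] -> mhas_proc G [] [] MNil
| M_EProm G L D x Cs P :
    mhas_proc G ((x, Cs) :: L) D P -> mhas_proc (GFun x Cs :: G) L D P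
| M_App G L D1 D2 V us m Cs :
    mhas_val G L D1 V (MFun m Cs) -> mann_ok V (MFun m Cs) ->
    mhas_chans G D2 us Cs ->
    mwf G L (D1 ++ D2) ->
    mhas_proc G L (D1 ++ D2) (MApp V us)
| M_Send G L1 L2 D D1 D2 u Us Vs P :
    Permutation (D1 ++ D2) ((u, MEnd) :: D) ->
    mhas_proc G L1 D1 P ->
    mhas_vals G L2 D2 Vs Us -> Forall2 mann_ok Vs Us ->
    mwf G (L1 ++ L2) ((u, MOut Us) :: D) ->
    mhas_proc G (L1 ++ L2) ((u, MOut Us) :: D) (MSend u Vs P)
| M_Rcv G L L2 D u Us xs P :
    NoDup xs ->
    mhas_proc G (L ++ L2) ((u, MEnd) :: D) P ->
    mhas_vals G L2 [] (map MVar xs) Us ->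
    mhas_proc (mgminus G xs) L ((u, MIn Us) :: D) (MRecv u xs P)
| M_Req G L D1 D2 u U V P :
    mhas_chan G [] u (MCShr U) ->
    mhas_proc G L D1 P ->
    mhas_val G [] D2 V U -> mann_ok V U ->
    mwf G L (D1 ++ D2) ->
    mhas_proc G L (D1 ++ D2) (MSend u [V] P)
| M_Acc G L L2 D u U x P :
    mhas_chan G [] u (MCShr U) ->
    mhas_proc G (L ++ L2) D P ->
    mhas_val G L2 [] (MVar x) U ->
    mhas_proc (mgminus G [x]) L D (MRecv u [x] P)
| M_Par G L1 L2 D1 D2 P Q :
    mhas_proc G L1 D1 P -> mhas_proc G L2 D2 Q ->
    mwf G (L1 ++ L2) (D1 ++ D2) ->
    mhas_proc G (L1 ++ L2) (D1 ++ D2) (MPar P Q)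
| M_End G L D u P :
    mhas_proc G L D P -> mwf G L ((u, MEnd) :: D) ->
    mhas_proc G L ((u, MEnd) :: D) P
| M_Res G L D a i U P :
    mhas_proc (GChan (TShr a i) U :: G) L D P ->
    mhas_proc G L D (MResShr a i U P)
| M_ResS G L D s ann M1 M2 P :
    mhas_proc G L ((TSes s false, M1) :: (TSes s true, M2) :: D) P ->
    M2 = mdual M1 ->
    ann = None \/ ann = Some M1 ->
    mhas_proc G L D (MResSes s ann P)
| M_Struct G G' L L' D D' P :
    mhas_proc G L D P ->
    incl G G' -> Permutation L L' -> Permutation D D' -> mwf G' L' D' ->
    mhas_proc G' L' D' P.

Definition ix (u : ident) (i : nat) : tident :=
  match u with
  | IShr a => TShr a i
  | ISes s co => TSes (SIx s i) co
  | IVar x => TVar (VIx x i)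
  end.

Definition next (u : tident) : tident :=
  match u with
  | TShr a i => TShr a (S i)
  | TSes (SIx s i) co => TSes (SIx s (S i)) co
  | TVar (VIx x i) => TVar (VIx x (S i))
  | _ => u
  end.

Definition index (u : tident) : nat :=
  match u with
  | TShr _ i | TSes (SIx _ i) _ | TVar (VIx _ i) => i
  | _ => 0
  end.

(* (u_i, ..., u_{i+n-1}) *)
Fixpoint slots (u : tident) (n : nat) : list tident :=
  match n with 0 => [] | S n' => u :: slots (next u) n' end.

(* {init(fn P)/fn P} *)
Definition init (P : proc) (u : ident) : tident :=
  if in_dec ident_eq_dec u (fn P) then ix u 1 else ix u 0.

Fixpoint GU (U : utype) : mutype :=
  match U with Fun m C => MFun m (GC C) end
with GC (C : ctype) : list mctype :=
  match C with
  | CSes T => map MCSes (GS T)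
  | CShr U => [MCShr (GU U)]
  end
with GS (S : stype) : list mtype :=
  match S with
  | SEnd => [MEnd]
  | SOut U S' => MOut [GU U] :: match S' with SEnd => [] | _ => GS S' end
  | SIn U S' => MIn [GU U] :: match S' with SEnd => [] | _ => GS S' end
  end.

Definition igenv := list (gentry tident tvar ctype utype).
Definition isenv := list (tident * stype).

Definition subst_genv (r : ident -> tident) : genv -> igenv :=
  map (fun g => match g with
                | GFun x C => GFun (VIx x 0) C
                | GChan u U => GChan (r u) U
                end).

Definition subst_senv (r : ident -> tident) : senv -> isenv :=
  map (fun e => (r (fst e), snd e)).

Definition Ggenv : igenv -> mgenv :=
  map (fun g => match g with
                | GFun x C => GFun x (GC C)
                | GChan u U => GChan u (GU U)
                end).

Definition Gsenv : isenv -> msenv :=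
  flat_map (fun e => combine (slots (fst e) (length (GS (snd e)))) (GS (snd e))).

Fixpoint deg (P : proc) : nat :=
  match P with
  | Send _ V Q => degV V + deg Q + 1
  | Recv _ _ Q => deg Q + 1
  | App V _ => degV V + 1
  | Par Q R => deg Q + deg R + 1
  | ResShr _ _ Q | ResSes _ _ Q => deg Q
  | Nil => 1
  end
with degV (V : val) : nat :=
  match V with
  | Abs Lin _ _ P => deg P
  | Abs Shr _ _ _ | Var _ => 0
  end.

(* The free higher-order variables: in a typable process these are the free
   variables that occur as values. *)
Fixpoint hofv (P : proc) : list nat :=
  match P with
  | Send _ V Q => nodup Nat.eq_dec (hofvV V ++ hofv Q)
  | Recv _ x Q => remove Nat.eq_dec x (hofv Q)
  | App V _ => hofvV V
  | Par Q R => nodup Nat.eq_dec (hofv Q ++ hofv R)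
  | ResShr _ _ Q | ResSes _ _ Q => hofv Q
  | Nil => []
  end
with hofvV (V : val) : list nat :=
  match V with
  | Var x => [x]
  | Abs _ x _ Q => remove Nat.eq_dec x (hofv Q)
  end.

Definition c_in (k : nat) (xs : list nat) (T : mproc) : mproc :=
  MRecv (TSes (SPg k) false)
    (match xs with [] => [VUnit] | _ => map (fun x => VIx x 0) xs end) T.

Definition c_out (k : nat) (xs : list nat) (T : mproc) : mproc :=
  MSend (TSes (SPg k) true)
    (match xs with
     | [] => [MAbs Shr [(VUnit, MCSes MEnd)] MNil]
     | _ => map (fun x => MVar (VIx x 0)) xs
     end) T.

(* (nu c_k ... c_{k+n-1}) T *)
Fixpoint c_res (k n : nat) (T : mproc) : mproc :=
  match n with 0 => T | S n' => MResSes (SPg k) None (c_res (S k) n' T) end.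

(* (nu s_i : M_1) ... (nu s_{i+n-1} : M_n) T *)
Fixpoint s_res (s i : nat) (Ms : list mtype) (T : mproc) : mproc :=
  match Ms with
  | [] => T
  | M :: Ms' => MResSes (SIx s i) (Some M) (s_res s (S i) Ms' T)
  end.

(* The type information used by the breakdown: the types of the channels in
   scope. *)
Definition tyinfo := tident -> option ctype.

Definition set_ty (E : tyinfo) (u : tident) (C : ctype) : tyinfo :=
  fun v => if tident_eq_dec v u then Some C else E v.

Definition set_id (r : ident -> tident) (u : ident) (v : tident) : ident -> tident :=
  fun w => if ident_eq_dec w u then v else r w.

Definition cont (S : stype) : stype :=
  match S with SEnd => SEnd | SOut _ S' | SIn _ S' => S' end.

(* The substitution {u_{i+1}/u_i} if u_i has a session type and {} otherwise,
   composed after [r]; and the type information for the continuation. *)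
Definition bump_id (E : tyinfo) (u : tident) (r : ident -> tident) : ident -> tident :=
  match E u with
  | Some (CSes _) => fun w => if tident_eq_dec (r w) u then next u else r w
  | _ => r
  end.

Definition bump_ty (E : tyinfo) (u : tident) : tyinfo :=
  match E u with
  | Some (CSes T) => set_ty E (next u) (CSes (cont T))
  | _ => E
  end.

Definition args (E : tyinfo) (u : tident) : list tident :=
  match E u with Some C => slots u (length (GC C)) | None => [u] end.

(* [B E r k xs P] is the breakdown of the process (P r): the substitution [r]
   of indexed names for plain ones is kept pending, which makes the recursion
   structural. *)
Fixpoint B (E : tyinfo) (r : ident -> tident) (k : nat) (xs : list nat) (P : proc)
    : mproc :=
  match P with
  | Send u V Q =>
      let E' := bump_ty E (r u) in
      let r' := bump_id E (r u) r in
      let l := degV V in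
      MPar (c_in k xs (MSend (r u) [BV E' r' (k + 1) (hofvV V) V]
                         (c_out (k + l + 1) (hofv Q) MNil)))
           (B E' r' (k + l + 1) (hofv Q) Q)
  | Recv u y Q =>
      let E' := bump_ty E (r u) in
      let r' := set_id (bump_id E (r u) r) (IVar y) (ix (IVar y) 0) in
      MPar (c_in k xs (MRecv (r u) [VIx y 0] (c_out (k + 1) (hofv Q) MNil)))
           (B E' r' (k + 1) (hofv Q) Q)
  | App V u => c_in k xs (MApp (BV E r (k + 1) xs V) (args E (r u)))
  | ResSes s T Q =>
      let E' := set_ty (set_ty E (ix (ISes s false) 1) (CSes T))
                       (ix (ISes s true) 1) (CSes (dual T)) in
      let r' := set_id (set_id r (ISes s false) (ix (ISes s false) 1))
                       (ISes s true) (ix (ISes s true) 1) in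
      s_res s 1 (GS T) (B E' r' k xs Q)
  | ResShr a U Q =>
      let E' := set_ty E (ix (IShr a) 1) (CShr U) in
      let r' := set_id r (IShr a) (ix (IShr a) 1) in
      MResShr a 1 (GU U) (B E' r' k xs Q)
  | Par Q R =>
      let l := deg Q in
      MPar (c_in k xs (c_out (k + 1) (hofv Q) (c_out (k + l + 1) (hofv R) MNil)))
           (MPar (B E r (k + 1) (hofv Q) Q) (B E r (k + l + 1) (hofv R) R))
  | Nil => c_in k [] MNil
  end
with BV (E : tyinfo) (r : ident -> tident) (k : nat) (xs : list nat) (V : val)
    : mval :=
  match V with
  | Var y => MVar (VIx y 0)
  | Abs m y C Q =>
      let E' := set_ty E (ix (IVar y) 1) C in
      let r' := set_id r (IVar y) (ix (IVar y) 1) in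
      let n := match m with Lin => 0 | Shr => deg Q end in
      MAbs m (combine (map (VIx y) (seq 1 (length (GC C)))) (GC C))
        (c_res k n (MPar (c_out k xs MNil) (B E' r' k xs Q)))
  end.

Definition info (G : igenv) (D : isenv) : tyinfo := fun u =>
  match find (fun g => match g with
                       | GChan v _ => if tident_eq_dec v u then true else false
                       | GFun _ _ => false
                       end) G with
  | Some (GChan _ U) => Some (CShr U)
  | _ =>
      match find (fun e => if tident_eq_dec (fst e) u then true else false) D with
      | Some (_, T) => Some (CSes T)
      | None => None
      end
  end.

Definition decompose (E : tyinfo) (k : nat) (P : proc) : mproc :=
  c_res k (deg P) (MPar (c_out k [] MNil) (B E (init P) k [] P)).

(* G provides no slot for the trailing end of a session type: a channel u_i of
   type !<U>;end or ?(U);end yields only u_i.  Yet after the communication the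
   breakdown refers to the channel as u_{i+1}, so that applying a value to it
   would mention a name without a type, as for
     P = s!<\y.0>.((\z.0) s)   with   s : !<end -o <>>;end   and   z : end,
   where D(P) contains s_2 but G(s_1 : !<end -o <>>;end) does not.
   [no_exhausted_arg] states that no value is applied to a channel that has
   already communicated and has reached the type end; such a channel has an
   index greater than 1. *)
Fixpoint no_exhausted_arg (E : tyinfo) (r : ident -> tident) (P : proc) : Prop :=
  match P with
  | Send u V Q =>
      let E' := bump_ty E (r u) in
      let r' := bump_id E (r u) r in
      no_exhausted_argV E' r' V /\ no_exhausted_arg E' r' Q
  | Recv u y Q =>
      no_exhausted_arg (bump_ty E (r u))
        (set_id (bump_id E (r u) r) (IVar y) (ix (IVar y) 0)) Q
  | App V u =>
      no_exhausted_argV E r V /\ (E (r u) = Some (CSes SEnd) -> index (r u) <= 1)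
  | ResSes s T Q =>
      no_exhausted_arg
        (set_ty (set_ty E (ix (ISes s false) 1) (CSes T))
                (ix (ISes s true) 1) (CSes (dual T)))
        (set_id (set_id r (ISes s false) (ix (ISes s false) 1))
                (ISes s true) (ix (ISes s true) 1)) Q
  | ResShr a U Q =>
      no_exhausted_arg (set_ty E (ix (IShr a) 1) (CShr U))
        (set_id r (IShr a) (ix (IShr a) 1)) Q
  | Par Q R => no_exhausted_arg E r Q /\ no_exhausted_arg E r R
  | Nil => True
  end
with no_exhausted_argV (E : tyinfo) (r : ident -> tident) (V : val) : Prop :=
  match V with
  | Var _ => True
  | Abs _ y C Q =>
      no_exhausted_arg (set_ty E (ix (IVar y) 1) C)
        (set_id r (IVar y) (ix (IVar y) 1)) Q
  end.

(* Main.v *)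
Require Import Defs.
From Stdlib Require Import List Permutation Arith Lia.
Import ListNotations.

(** By induction on the source derivation, [B E r k (hofv P) P] is typable in
    the minimal system: the shared channels keep their decomposed types, each
    session name [u : S] contributes its remaining slots, and the propagators
    [c_k, ..., c_{k + deg P - 1}] occur with both endpoints, except for [c_k],
    whose output endpoint is left to the context.

    Two observations shape the invariant.  First, EProm allows a variable
    received at a linear type to be kept in the shared environment, and a
    shared variable can be sent at either type; hence in the target every
    higher-order variable is shared, the linear environment stays empty, and
    the propagators always carry values of shared type.  Second, a session that
    has communicated and reached [end] has no slot left, which is exactly the
    case excluded from arguments by [no_exhausted_arg]. *)

(** * Lists *)

(** The types carried by the propagators depend on contexts computed deep inside the term, so the
    invariants assert only that a list [Us] of such types with the right length exists. This is
    enough because the restrictions of propagators carry no annotation. A linear abstraction leaves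
    its propagators unrestricted, so a translated value owns session names even when its source owns
    none. Promotion, which demands an empty session environment, is the delicate rule: it survives
    only because a value used at a shared type cannot be annotated as linear. Sender and receiver on
    a propagator must agree on the types of the forwarded variables although each context is
    recomputed from [hofv]. A total assignment [t] of types to variables therefore accompanies the
    induction, overwritten at each input binder. Every renaming in play only adds an index to an
    identifier. Disjointness of target keys thus reduces to disjointness of source domains; it is
    established once per typing rule for a large environment, and smaller ones inherit it. *)

Lemma NoDup_map_inj {A B} (f : A -> B) l a b :
  NoDup (map f l) -> In a l -> In b l -> f a = f b -> a = b.
Proof.
  induction l as [|c l IH]; simpl; [easy|].
  intros HN Ha Hb E. inversion_clear HN as [|? ? Hni HN'].
  destruct Ha as [->|Ha], Hb as [->|Hb]; auto.
  - exfalso. apply Hni. rewrite E. now apply in_map.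
  - exfalso. apply Hni. rewrite <- E. now apply in_map.
Qed.

Lemma NoDup_app_iff {A} (l1 l2 : list A) :
  NoDup (l1 ++ l2) <-> NoDup l1 /\ NoDup l2 /\ (forall a, In a l1 -> ~ In a l2).
Proof.
  split.
  - induction l1 as [|a l1 IH]; simpl; intros H.
    + repeat split; [constructor|assumption|easy].
    + inversion_clear H as [|? ? Hni HN]. destruct (IH HN) as (H1 & H2 & H3).
      rewrite in_app_iff in Hni.
      repeat split; [constructor; tauto|assumption|].
      intros b [<-|Hb]; [tauto|now apply H3].
  - intros (H1 & H2 & H3). now apply NoDup_app.
Qed.

Lemma flat_map_ext_in {A B} (f g : A -> list B) l :
  (forall a, In a l -> f a = g a) -> flat_map f l = flat_map g l.
Proof.
  induction l as [|a l IH]; simpl; intros H; [easy|].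
  rewrite H, IH; auto.
Qed.

Lemma map_fst_combine {A B} (l : list A) (l' : list B) :
  length l = length l' -> map fst (combine l l') = l.
Proof.
  revert l'; induction l as [|a l IH]; intros [|b l']; simpl; try easy.
  intros [= E]. now rewrite IH.
Qed.

Lemma map_snd_combine {A B} (l : list A) (l' : list B) :
  length l = length l' -> map snd (combine l l') = l'.
Proof.
  revert l'; induction l as [|a l IH]; intros [|b l']; simpl; try easy.
  intros [= E]. now rewrite IH.
Qed.

Lemma NoDup_nat_remove x l : NoDup l -> NoDup (remove Nat.eq_dec x l).
Proof.
  induction l as [|y l IH]; simpl; intros H; [constructor|].
  inversion_clear H as [|? ? Hni HN].
  destruct (Nat.eq_dec x y); [auto|].
  constructor; [|auto]. intros Hy. apply in_remove in Hy. tauto.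
Qed.

(** * Source typing *)

Scheme proc_mut := Induction for proc Sort Prop
  with val_mut := Induction for val Sort Prop.
Combined Scheme val_proc_ind from val_mut, proc_mut.

Scheme has_val_mut := Minimality for has_val Sort Prop
  with has_proc_mut := Minimality for has_proc Sort Prop.
Combined Scheme typing_ind from has_val_mut, has_proc_mut.

(** Disjointness in the form consumed by the freshness arguments: two memberships whose keys
    coincide are contradictory. *)
Lemma wf_entries G L D :
  wf G L D <->
  NoDup (map gkey G) /\ NoDup (map fst L) /\ NoDup (map fst D) /\
  (forall g, In g G -> forall C x, In (x, C) L -> gkey g <> IVar x) /\
  (forall g, In g G -> forall u T, In (u, T) D -> gkey g <> u) /\
  (forall x C, In (x, C) L -> forall T, ~ In (IVar x, T) D).
Proof.
  assert (E : map (fun e : nat * ctype => IVar (fst e)) L = map IVar (map fst L))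
    by now rewrite map_map.
  unfold wf. rewrite E, !NoDup_app_iff. split.
  - intros (H1 & (H2 & H3 & H4) & H5).
    repeat split; try assumption.
    + eapply NoDup_map_inv; eassumption.
    + intros g Hg C x Hx Ek. apply (H5 (gkey g)); [now apply in_map|].
      rewrite Ek, in_app_iff. left. apply in_map.
      now apply (in_map fst) in Hx.
    + intros g Hg u T Hu Ek. apply (H5 (gkey g)); [now apply in_map|].
      rewrite Ek, in_app_iff. right. now apply (in_map fst) in Hu.
    + intros x C Hx T HT. apply (H4 (IVar x)).
      * apply in_map. now apply (in_map fst) in Hx.
      * now apply (in_map fst) in HT.
  - intros (H1 & H2 & H3 & H4 & H5 & H6). repeat split; try assumption.
    + apply FinFun.Injective_map_NoDup; [|assumption]. intros ? ? [= ?]; easy.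
    + intros a Ha Hb. apply in_map_iff in Ha as (x & <- & Hx).
      apply in_map_iff in Hx as ((x' & C) & <- & Hx). simpl in *.
      apply in_map_iff in Hb as ((u & T) & Eu & Hu). simpl in *. subst.
      eapply H6; eassumption.
    + intros a Ha Hb. apply in_map_iff in Ha as (g & <- & Hg).
      rewrite in_app_iff in Hb. destruct Hb as [Hb|Hb].
      * apply in_map_iff in Hb as (x & E' & Hx).
        apply in_map_iff in Hx as ((x' & C) & <- & Hx).
        eapply H4; eauto.
      * apply in_map_iff in Hb as ((u & T) & Eu & Hu).
        eapply H5; eauto.
Qed.

Lemma in_gminus g G x : In g (gminus G x) <-> In g G /\ gkey g <> IVar x.
Proof.
  unfold gminus. rewrite filter_In. destruct (ident_eq_dec (gkey g) (IVar x));
    intuition congruence.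
Qed.

Lemma NoDup_gminus G x : NoDup (map gkey G) -> NoDup (map gkey (gminus G x)).
Proof.
  induction G as [|g G IH]; simpl; intros H; [constructor|].
  inversion_clear H as [|? ? Hni HN].
  destruct (ident_eq_dec (gkey g) (IVar x)); simpl; [auto|].
  constructor; [|auto]. intros Hg. apply Hni.
  apply in_map_iff in Hg as (g' & E & Hg'). rewrite <- E.
  apply in_map. apply in_gminus in Hg'. tauto.
Qed.

Lemma wf_sub G L D G' L' D' :
  NoDup (map gkey G') -> incl G' G ->
  NoDup (map fst L') -> incl L' L ->
  NoDup (map fst D') -> incl D' D ->
  wf G L D -> wf G' L' D'.
Proof.
  rewrite !wf_entries. intros N1 I1 N2 I2 N3 I3 (H1 & H2 & H3 & H4 & H5 & H6).
  repeat split; auto.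
  - intros g Hg C x Hx. eapply H4; eauto.
  - intros g Hg u T Hu. eapply H5; eauto.
  - intros x C Hx T HT. eapply H6; eauto.
Qed.

Lemma NoDup_map_app_l {A B} (f : A -> B) l l' :
  NoDup (map f (l ++ l')) -> NoDup (map f l).
Proof. rewrite map_app, NoDup_app_iff. tauto. Qed.

(** Several rules carry no [wf] premise of their own. EProm merely moves a key from [L] to [G], and
    the binding rules only remove keys, so well-formedness passes from their premises. *)
Lemma typing_wf :
  (forall G L D V U, has_val G L D V U -> wf G L D) /\
  (forall G L D P, has_proc G L D P -> wf G L D).
Proof.
  assert (EP : forall G L D x C, wf G ((x, C) :: L) D -> wf (GFun x C :: G) L D).
  { intros G L D x C. unfold wf. apply Permutation_NoDup. simpl.
    now rewrite <- Permutation_middle. }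
  assert (DROP : forall G L D L' D' x,
    wf G L' D' -> NoDup (map fst L) -> incl L L' ->
    NoDup (map fst D) -> incl D D' -> wf (gminus G x) L D).
  { intros G L D L' D' x HW **. eapply wf_sub; try eassumption.
    - apply NoDup_gminus. apply wf_entries in HW. tauto.
    - intros g Hg. apply in_gminus in Hg. tauto. }
  apply typing_ind; intros; eauto.
  - eapply DROP; [eassumption| | | |].
    + apply wf_entries in H0; tauto.
    + apply incl_refl.
    + apply wf_entries in H0 as (_ & _ & H0 & _).
      eapply NoDup_map_app_l; eassumption.
    + apply incl_appl, incl_refl.
  - assert (HL : NoDup (map fst L)).
    { apply wf_entries in H0 as (_ & H0 & _).
      eapply NoDup_map_app_l; eassumption. }
    change (wf (gminus G x) L ((u, SIn U S) :: D)).
    (* Only keys matter to [wf], so changing the type of [u] gives a convertible statement. *)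
    assert (W : wf G (L ++ L2) ((u, SIn U S) :: D)) by exact H0.
    eapply DROP; [exact W|exact HL|apply incl_appl, incl_refl| |apply incl_refl].
    apply wf_entries in H0 as (_ & _ & H0 & _). exact H0.
  - eapply DROP; [exact H1| |apply incl_appl, incl_refl| |apply incl_refl].
    + apply wf_entries in H1 as (_ & H1 & _).
      eapply NoDup_map_app_l; eassumption.
    + apply wf_entries in H1. tauto.
  - eapply wf_sub; [| | | | | |exact H0]; try apply incl_refl.
    + apply wf_entries in H0 as (H0 & _). now inversion H0.
    + apply incl_tl, incl_refl.
    + apply wf_entries in H0; tauto.
    + apply wf_entries in H0; tauto.
  - eapply wf_sub; [| | | | | |exact H0]; try apply incl_refl.
    + apply wf_entries in H0; tauto.
    + apply wf_entries in H0; tauto.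
    + apply wf_entries in H0 as (_ & _ & H0 & _). inversion_clear H0 as [|? ? _ N].
      now inversion N.
    + apply incl_tl, incl_tl, incl_refl.
Qed.

Definition val_wf := proj1 typing_wf.
Definition proc_wf := proj2 typing_wf.

(** Both environments are merged because EProm moves a variable between them, and the target keeps
    all such variables shared. *)
Definition ho_in (G : genv) (L : lenv) (x : nat) (C : ctype) : Prop :=
  In (GFun x C) G \/ In (x, C) L.

(** An induction, since EProm, Prom and structural steps may be interleaved below LVar. The last
    clause holds because [L] has no weakening; it identifies the linear part discharged by an input
    with the bound variable. *)
Lemma var_typing G L D x U :
  has_val G L D (Var x) U ->
  D = [] /\ exists m C, U = Fun m C /\ ho_in G L x C /\
  (forall y C', In (y, C') L -> y = x).
Proof.
  intros H. remember (Var x) as V eqn:EV.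
  induction H; try discriminate EV.
  - injection EV as ->. split; [reflexivity|].
    exists Lin, C. repeat split; [now right; left|].
    intros y C' [[= <- _]|[]]; easy.
  - destruct (IHhas_val EV) as (_ & m & C' & [= <- <-] & H1 & H2).
    split; [reflexivity|]. now exists Shr, C.
  - destruct (IHhas_val EV) as (-> & m & C' & -> & H1 & H2).
    split; [reflexivity|]. exists m, C'. split; [reflexivity|]. split.
    + destruct H1 as [H1|[H1|H1]]; [left; now right|left; left|now right].
      now injection H1 as -> ->.
    + intros y C'' Hy. apply (H2 y C''). now right.
  - destruct (IHhas_val EV) as (-> & m & C' & -> & H4 & H5).
    split; [now apply Permutation_nil|]. exists m, C'. split; [reflexivity|]. split.
    + destruct H4 as [H4|H4]; [left; now apply H0|right].
      eapply Permutation_in; eassumption.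
    + intros y C'' Hy. eapply H5. eapply Permutation_in;
        [apply Permutation_sym; eassumption|eassumption].
Qed.

(** Needed to separate the keys of the transmitted contexts from those of channels and sessions: a
    variable with a function entry cannot also be declared as a name. *)
Lemma hofv_typed :
  (forall G L D V U, has_val G L D V U ->
     forall x, In x (hofvV V) -> exists C, ho_in G L x C) /\
  (forall G L D P, has_proc G L D P ->
     forall x, In x (hofv P) -> exists C, ho_in G L x C).
Proof.
  assert (EP : forall G L x C y, (exists C', ho_in G ((x, C) :: L) y C') ->
    exists C', ho_in (GFun x C :: G) L y C').
  { intros G L x C y (C' & [H|[H|H]]); exists C'; unfold ho_in; simpl; auto.
    injection H as -> ->. auto. }
  assert (IN : forall G G' L L' x, (exists C', ho_in G L x C') -> incl G G' ->
    (forall C, In (x, C) L -> In (x, C) L') -> exists C', ho_in G' L' x C').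
  { intros G G' L L' x (C & [H|H]) ? ?; exists C; unfold ho_in; auto. }
  assert (MI : forall G L L' x y, (exists C', ho_in G (L ++ L') y C') ->
    (forall z C', In (z, C') L' -> z = x) -> y <> x ->
    exists C', ho_in (gminus G x) L y C').
  { intros G L L' x y (C & [H|H]) HL Hy; exists C; unfold ho_in.
    - left. apply in_gminus. split; [assumption|simpl; congruence].
    - right. apply in_app_iff in H as [H|H]; [assumption|].
      apply HL in H. congruence. }
  apply typing_ind; simpl; intros; auto.
  - destruct H0 as [<-|[]]. exists C. right. now left.
  - apply in_remove in H2 as [H2 Hx].
    apply MI with (L' := []); [|easy|assumption].
    rewrite app_nil_r. auto.
  - eapply IN; eauto. intros C. apply Permutation_in. assumption.
  - easy.
  - apply nodup_In, in_app_iff in H6 as [H6|H6].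
    + eapply IN; [apply H3, H6|apply incl_refl|].
      intros C HC. apply in_app_iff; auto.
    + eapply IN; [apply H1, H6|apply incl_refl|].
      intros C HC. apply in_app_iff; auto.
  - apply in_remove in H3 as [H3 Hx].
    eapply MI; [apply H0, H3| |assumption].
    apply var_typing in H1 as (_ & m & C & _ & _ & H1). exact H1.
  - apply nodup_In, in_app_iff in H6 as [H6|H6].
    + eapply IN; [apply H3, H6|apply incl_refl|easy].
    + eapply IN; [apply H1, H6|apply incl_refl|easy].
  - apply in_remove in H4 as [H4 Hx].
    eapply MI; [apply H1, H4| |assumption].
    apply var_typing in H2 as (_ & m & C & _ & _ & H2). exact H2.
  - apply nodup_In, in_app_iff in H4 as [H4|H4].
    + eapply IN; [apply H0, H4|apply incl_refl|].
      intros C HC. apply in_app_iff; auto.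
    + eapply IN; [apply H2, H4|apply incl_refl|].
      intros C HC. apply in_app_iff; auto.
  - destruct (H0 _ H1) as (C & [[H2|H2]|H2]); try discriminate;
      exists C; unfold ho_in; auto.
  - eapply IN; eauto. intros C. apply Permutation_in. assumption.
Qed.

Lemma NoDup_hofv :
  (forall V, NoDup (hofvV V)) /\ (forall P, NoDup (hofv P)).
Proof.
  apply val_proc_ind; simpl; intros;
    auto using NoDup_nodup, NoDup_nat_remove, NoDup_nil.
  repeat constructor. easy.
Qed.

(** Session environments have no weakening other than End, so a name absent from the term can only
    have type [SEnd]. This matters because [init] gives index 1 to free names only. *)
Lemma session_free :
  (forall G L D V U, has_val G L D V U ->
     forall u S, In (u, S) D -> S = SEnd \/ In u (freeV V)) /\
  (forall G L D P, has_proc G L D P ->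
     forall u S, In (u, S) D -> S = SEnd \/ In u (free P)).
Proof.
  assert (RM : forall u v l, In u l -> u <> v -> In u (remove ident_eq_dec v l))
    by (intros; now apply in_in_remove).
  apply typing_ind; simpl; intros; try easy; eauto.
  - destruct (H0 u S) as [?|?]; [now apply in_app_iff; left|now left|].
    right. apply RM; [assumption|]. intros ->.
    apply proc_wf, wf_entries in H as (W1 & _ & W2 & _ & W3 & _).
    inversion H1; subst.
    + rewrite map_app, NoDup_app_iff in W2. destruct W2 as (_ & _ & W2).
      apply (W2 (IVar x)); [|now left]. now apply (in_map fst) in H2.
    + eapply W3; [exact H4| |reflexivity]. apply in_app_iff; left; eassumption.
  - apply H0. eapply Permutation_in; [apply Permutation_sym|]; eassumption.
  - rewrite in_app_iff. apply in_app_iff in H4 as [H4|H4].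
    + destruct (H0 _ _ H4); auto.
    + right. inversion H2; subst; [|easy]. destruct H4 as [[= -> ->]|[]].
      simpl; auto.
  - destruct H6 as [[= <- <-]|H6]; [auto|].
    assert (H7 : In (u0, S0) (D1 ++ D2)).
    { eapply Permutation_in; [apply Permutation_sym; eassumption|now right]. }
    rewrite in_app_iff in *. destruct H7 as [H7|H7]; [destruct (H1 _ _ H7)|
      destruct (H3 _ _ H7)]; auto.
  - destruct H3 as [[= <- <-]|H3]; [auto|].
    destruct (H0 u0 S0) as [?|?]; [now right|now left|].
    right; right. apply RM; [assumption|]. intros ->.
    apply proc_wf, wf_entries in H as (W1 & _ & _ & _ & W2 & W3).
    apply var_typing in H1 as (_ & m & C & _ & [H1|H1] & _).
    + eapply W2; [exact H1|now right; eassumption|reflexivity].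
    + eapply W3; [apply in_app_iff; right; exact H1|right; exact H3].
  - rewrite in_app_iff in *. destruct H6 as [H6|H6].
    + destruct (H1 _ _ H6); auto.
    + destruct (H3 _ _ H6); auto.
  - destruct (H1 u0 S) as [?|?]; [assumption|now left|].
    right; right. apply RM; [assumption|]. intros ->.
    apply proc_wf, wf_entries in H0 as (W1 & _ & _ & _ & W2 & W3).
    apply var_typing in H2 as (_ & m & C & _ & [H2|H2] & _).
    + eapply W2; [exact H2|eassumption|reflexivity].
    + eapply W3; [apply in_app_iff; right; exact H2|exact H4].
  - rewrite in_app_iff in *. destruct H4 as [H4|H4].
    + destruct (H0 _ _ H4); auto.
    + destruct (H2 _ _ H4); auto.
  - destruct H2 as [[= <- <-]|H2]; auto.
  - destruct (H0 u S) as [?|?]; [assumption|now left|].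
    right. apply RM; [assumption|]. intros ->.
    apply proc_wf, wf_entries in H as (_ & _ & _ & _ & W & _).
    eapply W; [now left|eassumption|reflexivity].
  - destruct (H0 u S) as [?|?]; [now right; right|now left|].
    right. apply proc_wf, wf_entries in H as (_ & _ & W & _).
    simpl in W. inversion_clear W as [|? ? W1 W2].
    inversion_clear W2 as [|? ? W3 W4].
    apply (in_map fst) in H2. simpl in H2.
    apply RM; [apply RM; [assumption|]|]; intros ->; simpl in *; tauto.
  - apply H0 with (S := S). eapply Permutation_in; [apply Permutation_sym|]; eassumption.
Qed.

(** * Target typing *)

(** Function entries are dropped: a breakdown obtains its higher-order variables through its first
    propagator. *)
Definition chans (r : ident -> tident) : genv -> mgenv :=
  flat_map (fun g => match g with
                     | GFun _ _ => []
                     | GChan u U => [GChan (r u) (GU U)]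
                     end).

(** At index 1 a name of type [SEnd] has not communicated and still owns the slot given by [GS SEnd
    = [MEnd]]. A larger index means that it has moved past its last slot. *)
Definition exhausted (i : nat) (S : stype) : bool :=
  match S with SEnd => Nat.ltb 1 i | _ => false end.

Definition live (r : ident -> tident) : senv -> msenv :=
  flat_map (fun e => if exhausted (index (r (fst e))) (snd e) then []
                     else combine (slots (r (fst e)) (length (GS (snd e))))
                                  (GS (snd e))).

Arguments chans : simpl never.
Arguments live : simpl never.

Definition ctx_env (t : nat -> ctype) (xs : list nat) : mgenv :=
  map (fun x => GFun (VIx x 0) (GC (t x))) xs.

Definition ctx_types (t : nat -> ctype) (xs : list nat) : list mutype :=
  match xs with
  | [] => [MFun Shr [MCSes MEnd]]
  | _ => map (fun x => MFun Shr (GC (t x))) xs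
  end.

Definition pg_in (k : nat) : tident := TSes (SPg k) false.
Definition pg_out (k : nat) : tident := TSes (SPg k) true.

Fixpoint pg_env (k : nat) (Us : list (list mutype)) : msenv :=
  match Us with
  | [] => []
  | U :: Us' => (pg_in k, MIn U) :: (pg_out k, MOut U) :: pg_env (S k) Us'
  end.

Lemma pg_env_app k Us Us' :
  pg_env k (Us ++ Us') = pg_env k Us ++ pg_env (k + length Us) Us'.
Proof.
  revert k; induction Us as [|U Us IH]; intros k; simpl.
  - now rewrite Nat.add_0_r.
  - now rewrite IH, Nat.add_succ_r.
Qed.

Lemma slots_ix u i n : slots (ix u i) n = map (ix u) (seq i n).
Proof.
  revert i; induction n as [|n IH]; intros i; simpl; [easy|].
  rewrite <- IH. now destruct u.
Qed.

Lemma length_slots u n : length (slots u n) = n.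
Proof. revert u; induction n; simpl; auto. Qed.

Lemma ix_inj u v i j : ix u i = ix v j -> u = v /\ i = j.
Proof. destruct u, v; simpl; intros [=]; subst; auto. Qed.

Lemma next_ix u i : next (ix u i) = ix u (S i).
Proof. now destruct u. Qed.

Lemma index_ix u i : index (ix u i) = i.
Proof. now destruct u. Qed.

(** The underlying identifier can be recovered from any slot, so distinct identifiers have disjoint
    slots whatever their current indices. *)
Definition indexing (r : ident -> tident) : Prop := forall u, exists i, r u = ix u i.

Lemma indexing_inj r u v : indexing r -> r u = r v -> u = v.
Proof.
  intros Hr E. destruct (Hr u) as (i & Ei), (Hr v) as (j & Ej).
  rewrite Ei, Ej in E. now apply ix_inj in E.
Qed.

Lemma in_chans r G v :
  In v (map mgkey (chans r G)) <-> exists u U, In (GChan u U) G /\ v = r u.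
Proof.
  rewrite in_map_iff. unfold chans. split.
  - intros (g & <- & Hg). apply in_flat_map in Hg as ([x C|u U] & Hu & Hg); [easy|].
    destruct Hg as [<-|[]]. now exists u, U.
  - intros (u & U & Hu & ->). exists (GChan (r u) (GU U)). split; [easy|].
    apply in_flat_map. exists (GChan u U). simpl. auto.
Qed.

Lemma in_chans_intro r G u U : In (GChan u U) G -> In (GChan (r u) (GU U)) (chans r G).
Proof.
  intros H. apply in_flat_map. exists (GChan u U). simpl. auto.
Qed.

Lemma in_live r D v :
  indexing r -> In v (map fst (live r D)) ->
  exists u S i, In (u, S) D /\ v = ix u i.
Proof.
  intros Hr. unfold live. rewrite in_map_iff. intros ((v' & M) & <- & H).
  apply in_flat_map in H as ((u & S) & Hu & H). simpl in *.
  destruct exhausted; [easy|].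
  apply in_combine_l in H. destruct (Hr u) as (i & Ei).
  rewrite Ei, slots_ix in H. apply in_map_iff in H as (j & <- & _).
  now exists u, S, j.
Qed.

Lemma in_pg_env k Us v :
  In v (map fst (pg_env k Us)) -> exists j co, v = TSes (SPg j) co /\ k <= j.
Proof.
  revert k; induction Us as [|U Us IH]; simpl; intros k; [easy|].
  intros [<-|[<-|H]].
  - exists k, false. auto.
  - exists k, true. auto.
  - apply IH in H as (j & co & -> & Hj). exists j, co. split; [easy|lia].
Qed.

Lemma NoDup_chans r G :
  indexing r -> NoDup (map gkey G) -> NoDup (map mgkey (chans r G)).
Proof.
  intros Hr. unfold chans. induction G as [|g G IH]; simpl; intros H; [constructor|].
  inversion_clear H as [|? ? Hni HN]. rewrite map_app.
  destruct g as [x C|u U]; simpl; [auto|]. constructor; [|auto].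
  intros Hu. apply in_chans in Hu as (v & U' & Hv & E).
  apply indexing_inj in E; [|assumption]. subst v.
  apply Hni. now apply (in_map gkey) in Hv.
Qed.

Lemma NoDup_slots r u n : indexing r -> NoDup (slots (r u) n).
Proof.
  intros Hr. destruct (Hr u) as (i & ->). rewrite slots_ix.
  apply FinFun.Injective_map_NoDup; [|apply seq_NoDup].
  intros a b E. now apply ix_inj in E.
Qed.

Lemma NoDup_live r D :
  indexing r -> NoDup (map fst D) -> NoDup (map fst (live r D)).
Proof.
  intros Hr. unfold live. induction D as [|(u & S) D IH]; simpl; intros H; [constructor|].
  inversion_clear H as [|? ? Hni HN]. rewrite map_app. apply NoDup_app; auto.
  - destruct exhausted; [constructor|].
    rewrite map_fst_combine by apply length_slots. now apply NoDup_slots.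
  - intros v Hv Hv'. apply in_live in Hv' as (w & S' & i & Hw & ->); [|assumption].
    assert (E : exists j, ix w i = ix u j).
    { destruct exhausted; [easy|].
      rewrite map_fst_combine in Hv by apply length_slots.
      destruct (Hr u) as (j & Ej). rewrite Ej, slots_ix in Hv.
      apply in_map_iff in Hv as (j' & E & _). now exists j'. }
    destruct E as (j & E). apply ix_inj in E as (-> & _).
    apply Hni. now apply (in_map fst) in Hw.
Qed.

Lemma NoDup_pg_env k Us : NoDup (map fst (pg_env k Us)).
Proof.
  revert k; induction Us as [|U Us IH]; simpl; intros k; [constructor|].
  constructor; [|constructor; [|auto]].
  - intros [E|H]; [discriminate|].
    apply in_pg_env in H as (j & co & [= <- <-] & Hj). lia.
  - intros H. apply in_pg_env in H as (j & co & [= <- <-] & Hj). lia.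
Qed.

(* Well-formedness of target environments is handled by counting keys: it then
   passes to sub-environments by linear arithmetic. *)
Definition ind (u v : tident) : nat := if tident_eq_dec u v then 1 else 0.

Lemma occ_nil v : count_occ tident_eq_dec [] v = 0.
Proof. easy. Qed.

Lemma occ_cons u l v :
  count_occ tident_eq_dec (u :: l) v = ind u v + count_occ tident_eq_dec l v.
Proof. unfold ind. simpl. now destruct tident_eq_dec. Qed.

Lemma occ_nodup l : NoDup l <-> forall v, count_occ tident_eq_dec l v <= 1.
Proof. apply NoDup_count_occ. Qed.

Lemma mwf_occ G D :
  mwf G [] D <->
  forall v, count_occ tident_eq_dec (map mgkey G) v
            + count_occ tident_eq_dec (map fst D) v <= 1.
Proof.
  unfold mwf. simpl. rewrite occ_nodup. split; intros H v; specialize (H v);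
    rewrite count_occ_app in *; assumption.
Qed.

Lemma mwf_perm G D D' : Permutation D D' -> mwf G [] D -> mwf G [] D'.
Proof. intros HD. unfold mwf. simpl. now rewrite HD. Qed.

Ltac occ_simpl_in H :=
  simpl map in H; unfold pg_in, pg_out in H;
  repeat first [rewrite map_app in H | rewrite count_occ_app in H
               | rewrite occ_cons in H | rewrite occ_nil in H
               | progress simpl map in H].

(** Meant for goals whose keys form a sub-multiset of those of [H]; types may differ, since only
    keys are counted, and [lia] compares the counts at an arbitrary key. *)
Ltac mwf_from H :=
  let v := fresh "v" in
  apply mwf_occ; intros v;
  let H' := fresh "H" in
  pose proof (proj1 (mwf_occ _ _) H v) as H';
  simpl map; unfold pg_in, pg_out;
  repeat first [rewrite map_app | rewrite count_occ_app
               | rewrite occ_cons | rewrite occ_nil | progress simpl map];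
  occ_simpl_in H';
  lia.

(** Propagators and [VUnit] have constructors that [ix] never produces. A clash of a context
    variable with a channel or a session slot would force the identifier [IVar x], declared both as
    a function and as a name, against [wf]. [VUnit] is included to cover empty contexts. *)
Lemma target_wf t r G L D xs k Us :
  indexing r -> wf G L D -> NoDup xs ->
  (forall x, In x xs -> exists C, ho_in G L x C) ->
  mwf (GFun VUnit [MCSes MEnd] :: ctx_env t xs ++ chans r G) []
      (pg_env k Us ++ live r D).
Proof.
  intros Hr HW Hxs Hin.
  apply wf_entries in HW as (W1 & W2 & W3 & W4 & W5 & W6).
  assert (K : map mgkey (ctx_env t xs) = map (fun x => TVar (VIx x 0)) xs)
    by (unfold ctx_env; now rewrite map_map).
  unfold mwf. simpl. rewrite !map_app, K.
  constructor; [|apply NoDup_app; [apply NoDup_app|apply NoDup_app|]].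
  - rewrite !in_app_iff. intros [[H|H]|[H|H]].
    + apply in_map_iff in H as (x & [=] & _).
    + apply in_chans in H as (u & U & _ & E). destruct (Hr u) as (i & Ei).
      rewrite Ei in E. now destruct u.
    + apply in_pg_env in H as (j & co & [=] & _).
    + apply in_live in H as (u & S & i & _ & E); [|assumption]. now destruct u.
  - apply FinFun.Injective_map_NoDup; [|assumption]. now intros ? ? [=].
  - now apply NoDup_chans.
  - intros v Hv Hv'. apply in_map_iff in Hv as (x & <- & Hx).
    apply in_chans in Hv' as (u & U & Hu & E).
    destruct (Hr u) as (i & Ei). rewrite Ei in E.
    assert (u = IVar x) by (destruct u; simpl in E; congruence). subst u.
    destruct (Hin x Hx) as (C & [HC|HC]).
    + assert (E' : GFun x C = GChan (IVar x) U :> gentry ident nat ctype utype)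
        by (eapply NoDup_map_inj; eauto).
      discriminate E'.
    + eapply (W4 _ Hu); [eassumption|reflexivity].
  - apply NoDup_pg_env.
  - now apply NoDup_live.
  - intros v Hv Hv'. apply in_pg_env in Hv as (j & co & -> & _).
    apply in_live in Hv' as (u & S & i & _ & E); [|assumption]. now destruct u.
  - intros v. rewrite !in_app_iff. intros [Hv|Hv] [Hv'|Hv'].
    + apply in_map_iff in Hv as (x & <- & Hx).
      apply in_pg_env in Hv' as (j & co & [=] & _).
    + apply in_map_iff in Hv as (x & <- & Hx).
      apply in_live in Hv' as (u & S & i & Hu & E); [|assumption].
      assert (u = IVar x) by (destruct u; simpl in E; congruence). subst u.
      destruct (Hin x Hx) as (C & [HC|HC]).
      * eapply (W5 _ HC); [eassumption|reflexivity].
      * eapply W6; eassumption.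
    + apply in_chans in Hv as (u & U & Hu & ->).
      apply in_pg_env in Hv' as (j & co & E & _).
      destruct (Hr u) as (i & Ei). rewrite Ei in E. now destruct u.
    + apply in_chans in Hv as (u & U & Hu & ->).
      apply in_live in Hv' as (w & S & i & Hw & E); [|assumption].
      destruct (Hr u) as (j & Ej). rewrite Ej in E. apply ix_inj in E as (-> & _).
      eapply (W5 _ Hu); [eassumption|reflexivity].
Qed.

(** * Permutations of concatenated blocks *)

Lemma perm_pick {A} (x l r r' : list A) :
  Permutation r (x ++ r') -> Permutation l r' -> Permutation (x ++ l) r.
Proof. intros H1 H2. now rewrite H1, H2. Qed.

Lemma perm_pick_cons {A} (a : A) (l r r' : list A) :
  Permutation r (a :: r') -> Permutation l r' -> Permutation (a :: l) r.
Proof. intros H1 H2. now rewrite H1, H2. Qed.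

Lemma perm_skip_app {A} (x y r r' : list A) :
  Permutation r (x ++ r') -> Permutation (y ++ r) (x ++ y ++ r').
Proof. intros ->. rewrite !app_assoc. now rewrite (Permutation_app_comm y x). Qed.

Lemma perm_skip_app_cons {A} (b : A) (x r r' : list A) :
  Permutation r (x ++ r') -> Permutation (b :: r) (x ++ b :: r').
Proof. intros ->. apply Permutation_middle. Qed.

Lemma perm_skip_cons_app {A} (a : A) (y r r' : list A) :
  Permutation r (a :: r') -> Permutation (y ++ r) (a :: y ++ r').
Proof. intros ->. symmetry. apply Permutation_middle. Qed.

Lemma perm_skip_cons {A} (a b : A) (r r' : list A) :
  Permutation r (a :: r') -> Permutation (b :: r) (a :: b :: r').
Proof. intros ->. apply perm_swap. Qed.

(** Locates one block of the left list inside the right one; the remainder [r'] is an existential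
    variable, instantiated as the search skips blocks. *)
Ltac perm_find :=
  first [ reflexivity
        | eapply perm_skip_app; perm_find | eapply perm_skip_app_cons; perm_find
        | eapply perm_skip_cons_app; perm_find | eapply perm_skip_cons; perm_find ].

Ltac perm_loop :=
  lazymatch goal with
  | |- Permutation [] _ => apply Permutation_refl
  | |- Permutation (_ :: _) _ => eapply perm_pick_cons; [solve [perm_find]|perm_loop]
  | |- Permutation (_ ++ _) _ => eapply perm_pick; [solve [perm_find]|perm_loop]
  end.

Ltac perm :=
  lazymatch goal with
  | |- Permutation ?l ?r => rewrite <- (app_nil_r l), <- (app_nil_r r)
  end;
  repeat progress (rewrite <- ?app_assoc; simpl app); perm_loop.

(** * Derived target rules with an empty linear environment *)

Lemma proc_struct G G' D D' P :
  mhas_proc G [] D P -> incl G G' -> Permutation D D' -> mwf G' [] D' ->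
  mhas_proc G' [] D' P.
Proof. intros. eapply M_Struct; eauto. Qed.

Lemma val_struct G G' D D' V U :
  mhas_val G [] D V U -> incl G G' -> Permutation D D' -> mwf G' [] D' ->
  mhas_val G' [] D' V U.
Proof. intros. eapply M_StructV; eauto. Qed.

(** LVar followed by EProm uses a shared entry at a linear type, and Prom then gives the shared
    type. Hence shared entries serve both modes. *)
Lemma shared_var G x m Cs :
  mwf G [] [] -> In (GFun x Cs) G -> mhas_val G [] [] (MVar x) (MFun m Cs).
Proof.
  intros HW Hx.
  assert (H : mhas_val G [] [] (MVar x) (MFun Lin Cs)).
  { apply val_struct with (G := [GFun x Cs]) (D := []); auto.
    - apply M_EPromV, M_LVar. repeat constructor. easy.
    - now intros ? [<-|[]]. }
  destruct m; [exact H|now apply M_Prom].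
Qed.

Lemma closed_vals G Vs Us :
  mwf G [] [] -> Forall2 (mhas_val G [] []) Vs Us -> mhas_vals G [] [] Vs Us.
Proof.
  intros HW. induction 1 as [|V U Vs Us HV _ IH].
  - now constructor.
  - now apply (@M_ValsCons G [] [] [] [] V Vs U Us).
Qed.

(** One list of triples keeps variables, modes of use and argument types aligned. *)
Lemma shared_vars G (e : list (tvar * mode * list mctype)) :
  mwf G [] [] -> (forall x m Cs, In (x, m, Cs) e -> In (GFun x Cs) G) ->
  mhas_vals G [] [] (map (fun p => MVar (fst (fst p))) e)
    (map (fun p => MFun (snd (fst p)) (snd p)) e).
Proof.
  intros HW He. apply closed_vals; [assumption|].
  induction e as [|((x & m) & Cs) e IH]; simpl; constructor.
  - apply shared_var; [assumption|]. apply (He x m). now left.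
  - apply IH. intros y m' Cs' Hy. apply (He y m'). now right.
Qed.

(* Received variables may be kept in the shared environment even when they are
   received at a linear type, by EProm. *)
Lemma recv_shared G D u (e : list (tvar * mode * list mctype)) P :
  let Ge := map (fun p => GFun (fst (fst p)) (snd p)) e in
  mwf (Ge ++ G) [] ((u, MEnd) :: D) ->
  mhas_proc (Ge ++ G) [] ((u, MEnd) :: D) P ->
  mhas_proc G [] ((u, MIn (map (fun p => MFun (snd (fst p)) (snd p)) e)) :: D)
    (MRecv u (map (fun p => fst (fst p)) e) P).
Proof.
  intros Ge HW HP.
  assert (K : map mgkey Ge = map TVar (map (fun p => fst (fst p)) e))
    by (unfold Ge; now rewrite !map_map).
  (* The rule is applied with nothing linear to discharge ([L2 = []]). It removes the keys of [Ge],
     so the result is included in [G], and weakening restores [G]. *)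
  apply proc_struct with (G := mgminus (Ge ++ G) (map (fun p => fst (fst p)) e))
    (D := (u, MIn (map (fun p => MFun (snd (fst p)) (snd p)) e)) :: D);
    [|intros g Hg|reflexivity|mwf_from HW].
  - apply M_Rcv with (L2 := []).
    + apply (NoDup_map_inv TVar). rewrite <- K.
      unfold mwf in HW. rewrite map_app, !NoDup_app_iff in HW. tauto.
    + exact HP.
    + rewrite map_map. apply shared_vars.
      * mwf_from HW.
      * intros x m Cs Hx. apply in_app_iff. left. unfold Ge.
        apply in_map_iff. now exists (x, m, Cs).
  - apply filter_In in Hg as (Hg & Hk). apply in_app_iff in Hg as [Hg|Hg]; [|easy].
    destruct in_dec as [|Hn]; [easy|]. exfalso. apply Hn. rewrite <- K.
    now apply in_map.
Qed.

Lemma accept_shared G D u x m Cs P :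
  In (GChan u (MFun m Cs)) G ->
  mwf (GFun x Cs :: G) [] D ->
  mhas_proc (GFun x Cs :: G) [] D P ->
  mhas_proc G [] D (MRecv u [x] P).
Proof.
  intros Hu HW HP.
  apply proc_struct with (G := mgminus (GFun x Cs :: G) [x]) (D := D);
    [|intros g Hg|reflexivity|mwf_from HW].
  - apply M_Acc with (L2 := []) (U := MFun m Cs).
    + apply M_Sh; [mwf_from HW|now right].
    + exact HP.
    + apply shared_var; [mwf_from HW|now left].
  - apply filter_In in Hg as ([<-|Hg] & Hk); [|easy].
    destruct in_dec as [|Hn]; [easy|]. exfalso. apply Hn. now left.
Qed.

Lemma send_ok G D D1 D2 u Us Vs P :
  mhas_proc G [] ((u, MEnd) :: D1) P ->
  mhas_vals G [] D2 Vs Us -> Forall2 mann_ok Vs Us ->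
  Permutation D ((u, MOut Us) :: D1 ++ D2) ->
  mwf G [] D ->
  mhas_proc G [] D (MSend u Vs P).
Proof.
  intros HP HV HA HD HW.
  apply proc_struct with (G := G) (D := (u, MOut Us) :: D1 ++ D2);
    [|apply incl_refl|now symmetry|assumption].
  apply (@M_Send G [] [] (D1 ++ D2) ((u, MEnd) :: D1) D2 u Us Vs P); auto.
  unfold mwf in *. simpl in *. now rewrite HD in HW.
Qed.

Lemma par_ok G D D1 D2 P Q :
  mhas_proc G [] D1 P -> mhas_proc G [] D2 Q ->
  Permutation D (D1 ++ D2) -> mwf G [] D -> mhas_proc G [] D (MPar P Q).
Proof.
  intros HP HQ HD HW.
  apply proc_struct with (G := G) (D := D1 ++ D2);
    [|apply incl_refl|now symmetry|assumption].
  apply (@M_Par G [] [] D1 D2 P Q); auto.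
  unfold mwf in *. simpl in *. now rewrite HD in HW.
Qed.

Lemma mnil_ok G us :
  mwf G [] (map (fun u => (u, MEnd)) us) ->
  mhas_proc G [] (map (fun u => (u, MEnd)) us) MNil.
Proof.
  induction us as [|u us IH]; simpl; intros HW.
  - now apply M_Nil.
  - apply M_End; [apply IH; mwf_from HW|assumption].
Qed.

Lemma ctx_env_entry t xs x C :
  In x xs -> t x = C -> In (GFun (VIx x 0) (GC C)) (ctx_env t xs).
Proof. intros Hx <-. apply in_map_iff. now exists x. Qed.

Lemma c_in_ok t G D k xs T :
  mwf (GFun VUnit [MCSes MEnd] :: ctx_env t xs ++ G) [] ((pg_in k, MEnd) :: D) ->
  mhas_proc (ctx_env t xs ++ G) [] ((pg_in k, MEnd) :: D) T ->
  mhas_proc G [] ((pg_in k, MIn (ctx_types t xs)) :: D) (c_in k xs T).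
Proof.
  intros HW HT. unfold c_in. destruct xs as [|x xs].
  (* An empty context still transmits one value; the entry of [VUnit] is added to the body by
     weakening. *)
  - apply (@recv_shared G D (pg_in k) [(VUnit, Shr, [MCSes MEnd])]); [exact HW|].
    simpl in *. eapply proc_struct; [exact HT|apply incl_tl, incl_refl|reflexivity|].
    exact HW.
  - pose (e := map (fun x => (VIx x 0, Shr, GC (t x))) (x :: xs)).
    replace (map (fun x => VIx x 0) (x :: xs)) with (map (fun p => fst (fst p)) e)
      by (unfold e; now rewrite map_map).
    replace (ctx_types t (x :: xs))
      with (map (fun p => MFun (snd (fst p)) (snd p)) e)
      by (unfold e; now rewrite map_map).
    assert (E : ctx_env t (x :: xs) = map (fun p => GFun (fst (fst p)) (snd p)) e)
      by (unfold e, ctx_env; now rewrite map_map).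
    rewrite E in *. apply recv_shared; [mwf_from HW|exact HT].
Qed.

Lemma unit_val_ok G :
  mwf G [] [] ->
  mhas_val G [] [] (MAbs Shr [(VUnit, MCSes MEnd)] MNil) (MFun Shr [MCSes MEnd]).
Proof.
  intros HW. apply M_Prom.
  apply val_struct with (G := []) (D := []);
    [|easy|reflexivity|assumption].
  apply (@M_Abs [] [] [] [(TVar VUnit, MEnd)] Shr [(VUnit, MCSes MEnd)] MNil).
  - repeat constructor. easy.
  - apply (@mnil_ok [] [TVar VUnit]). repeat constructor. easy.
  - apply (@M_ChansCons [] [(TVar VUnit, MEnd)] [] (TVar VUnit) [] (MCSes MEnd) []).
    + apply M_Sess. repeat constructor. easy.
    + apply M_ChansNil. constructor.
    + repeat constructor. easy.
Qed.

Lemma c_out_ok t G D k xs T :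
  mwf G [] ((pg_out k, MEnd) :: D) ->
  incl (ctx_env t xs) G ->
  mhas_proc G [] ((pg_out k, MEnd) :: D) T ->
  mhas_proc G [] ((pg_out k, MOut (ctx_types t xs)) :: D) (c_out k xs T).
Proof.
  intros HW Hxs HT. unfold c_out.
  (* Neither shared variables nor the unit abstraction consume session names, so the payload owns
     nothing and a variable may be forwarded by several outputs. *)
  apply send_ok with (D1 := D) (D2 := []) (Us := ctx_types t xs).
  - exact HT.
  - apply closed_vals; [mwf_from HW|]. destruct xs as [|x xs].
    + constructor; [|constructor]. apply unit_val_ok. mwf_from HW.
    + unfold ctx_types; cbv iota. induction (x :: xs) as [|y ys IH]; simpl; constructor.
      * apply shared_var; [mwf_from HW|]. apply Hxs. now left.
      * apply IH. intros g Hg. apply Hxs. now right.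
  - destruct xs as [|x xs].
    + repeat constructor.
    + unfold ctx_types; cbv iota. clear Hxs.
      induction (x :: xs) as [|y ys IH]; simpl; constructor; easy.
  - now rewrite app_nil_r.
  - mwf_from HW.
Qed.

(** The missing annotation lets the payload types [Us] be arbitrary, which is why the invariants may
    leave them existential. *)
Lemma c_res_ok G D k Us T :
  mhas_proc G [] (pg_env k Us ++ D) T -> mwf G [] (pg_env k Us ++ D) ->
  mhas_proc G [] D (c_res k (length Us) T).
Proof.
  revert k D. induction Us as [|U Us IH]; simpl; intros k D HT HW; [exact HT|].
  apply M_ResS with (M1 := MIn U) (M2 := MOut U); [|easy|now left].
  apply IH.
  - eapply proc_struct; [exact HT|apply incl_refl|unfold pg_in, pg_out; perm|].
    mwf_from HW.
  - mwf_from HW.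
Qed.

(** Payloads are not dualised, and [dual] maps [SEnd] to itself, so the special treatment of a
    trailing end is triggered on both sides alike. *)
Lemma GS_dual S : GS (dual S) = map mdual (GS S).
Proof.
  induction S as [|U S IH|U S IH]; simpl; [easy| |]; f_equal;
    destruct S; simpl in *; easy.
Qed.

Lemma s_res_ok G D s i Ms T :
  mhas_proc G []
    (combine (slots (ix (ISes s false) i) (length Ms)) Ms
     ++ combine (slots (ix (ISes s true) i) (length Ms)) (map mdual Ms) ++ D) T ->
  mwf G []
    (combine (slots (ix (ISes s false) i) (length Ms)) Ms
     ++ combine (slots (ix (ISes s true) i) (length Ms)) (map mdual Ms) ++ D) ->
  mhas_proc G [] D (s_res s i Ms T).
Proof.
  revert i D. induction Ms as [|M Ms IH]; simpl; intros i D HT HW; [exact HT|].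
  apply M_ResS with (M1 := M) (M2 := mdual M); [|easy|now right].
  apply IH; simpl.
  - eapply proc_struct; [exact HT|apply incl_refl|perm|]. mwf_from HW.
  - mwf_from HW.
Qed.

(** * The typing invariant of the breakdown *)

(** [compat_pos] keeps [exhausted] faithful: a communication at index 0 would lead to index 1, which
    still counts as owning a slot. Index 0 is tolerated only at [SEnd], where no communication
    remains. *)
Record compat (t : nat -> ctype) (E : tyinfo) (r : ident -> tident)
    (G : genv) (L : lenv) (D : senv) : Prop := {
  compat_ix : indexing r;
  compat_ses : forall u S, In (u, S) D -> E (r u) = Some (CSes S);
  compat_pos : forall u S, In (u, S) D -> S = SEnd \/ 1 <= index (r u);
  compat_shr : forall u U, In (GChan u U) G -> E (r u) = Some (CShr U);
  compat_ho : forall x C, ho_in G L x C -> t x = C }.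

Lemma compat_sub t E r G L D G' L' D' :
  compat t E r G L D ->
  (forall u U, In (GChan u U) G' -> In (GChan u U) G) ->
  (forall x C, ho_in G' L' x C -> ho_in G L x C) ->
  incl D' D ->
  compat t E r G' L' D'.
Proof. intros [H1 H2 H3 H4 H5] HG HL HD. split; eauto. Qed.

Lemma set_id_ix r u i : indexing r -> indexing (set_id r u (ix u i)).
Proof.
  intros Hr v. unfold set_id. destruct (ident_eq_dec v u) as [->|_]; [|apply Hr].
  now exists i.
Qed.

Lemma set_id_eq r u w : set_id r u w u = w.
Proof. unfold set_id. now destruct ident_eq_dec. Qed.

Lemma set_id_neq r u w v : v <> u -> set_id r u w v = r v.
Proof. unfold set_id. now destruct ident_eq_dec. Qed.

Lemma set_ty_eq E u C : set_ty E u C u = Some C.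
Proof. unfold set_ty. now destruct tident_eq_dec. Qed.

Lemma set_ty_ix E r u i v C :
  indexing r -> v <> u -> set_ty E (ix u i) C (r v) = E (r v).
Proof.
  intros Hr Hv. unfold set_ty. destruct tident_eq_dec as [e|_]; [|easy].
  destruct (Hr v) as (j & Ej). rewrite Ej in e. apply ix_inj in e. tauto.
Qed.

Lemma bump_id_eq E r u T :
  E (r u) = Some (CSes T) -> bump_id E (r u) r u = next (r u).
Proof. intros HE. unfold bump_id. rewrite HE. now destruct tident_eq_dec. Qed.

Lemma bump_id_neq E r u v :
  indexing r -> v <> u -> bump_id E (r u) r v = r v.
Proof.
  intros Hr Hv. unfold bump_id. destruct (E (r u)) as [[T|U]|]; try easy.
  destruct tident_eq_dec as [e|_]; [|easy].
  now apply indexing_inj in e.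
Qed.

Lemma bump_id_ix E r u : indexing r -> indexing (bump_id E (r u) r).
Proof.
  intros Hr v. destruct (ident_eq_dec v u) as [->|Hv].
  - destruct (Hr u) as (i & Ei). unfold bump_id.
    destruct (E (r u)) as [[T|U]|]; try (exists i; assumption).
    destruct tident_eq_dec; [|easy]. exists (S i). now rewrite Ei, next_ix.
  - rewrite bump_id_neq by assumption. apply Hr.
Qed.

Lemma chans_ext r r' G :
  (forall u U, In (GChan u U) G -> r' u = r u) -> chans r' G = chans r G.
Proof.
  intros H. apply flat_map_ext_in. intros [x C|u U] Hu; [easy|].
  now rewrite (H u U).
Qed.

Lemma live_ext r r' D :
  (forall u S, In (u, S) D -> r' u = r u) -> live r' D = live r D.
Proof.
  intros H. apply flat_map_ext_in. intros (u & S) Hu. simpl. now rewrite (H u S).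
Qed.

Lemma live_cons r u S D :
  live r ((u, S) :: D) =
  (if exhausted (index (r u)) S then []
   else combine (slots (r u) (length (GS S))) (GS S)) ++ live r D.
Proof. reflexivity. Qed.

Lemma live_app r D D' : live r (D ++ D') = live r D ++ live r D'.
Proof. apply flat_map_app. Qed.

Lemma live_perm r D D' : Permutation D D' -> Permutation (live r D) (live r D').
Proof. intros H. unfold live. now rewrite H. Qed.

Lemma chans_incl r G G' : incl G G' -> incl (chans r G) (chans r G').
Proof.
  intros H g Hg. apply in_flat_map in Hg as (g' & Hg' & Hg).
  apply in_flat_map. exists g'. auto.
Qed.

Lemma ctx_env_incl t xs ys : incl xs ys -> incl (ctx_env t xs) (ctx_env t ys).
Proof. apply incl_map. Qed.

(** * Advancing a session name past an input or output *)

Definition is_prefix_of (U : utype) (S T : stype) : Prop :=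
  T = SOut U S \/ T = SIn U S.

Section Bump.
Context (t : nat -> ctype) (E : tyinfo) (r : ident -> tident)
  (G : genv) (L : lenv) (D : senv) (u : ident) (U : utype) (S0 T : stype).
Context (HC : compat t E r G L ((u, T) :: D)).
Context (HW : wf G L ((u, T) :: D)).
Context (HT : is_prefix_of U S0 T).

Let r' := bump_id E (r u) r.

Lemma bump_E : E (r u) = Some (CSes T).
Proof. eapply compat_ses; [exact HC|now left]. Qed.

Lemma bump_fresh v S : In (v, S) D -> v <> u.
Proof.
  intros Hv ->. apply wf_entries in HW as (_ & _ & H & _).
  inversion_clear H as [|? ? H1 _]. apply H1. now apply (in_map fst) in Hv.
Qed.

Lemma bump_fresh_chan v V : In (GChan v V) G -> v <> u.
Proof.
  intros Hv ->. apply wf_entries in HW as (_ & _ & _ & _ & H & _).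
  eapply H; [exact Hv|now left|reflexivity].
Qed.

Lemma bump_pos : 1 <= index (r u).
Proof.
  destruct (compat_pos _ _ _ _ _ _ HC u T) as [->|H]; [now left| |assumption].
  now destruct HT.
Qed.

(** The type of the consumed slot stays recorded in the type information, but [r'] sends [u] to the
    next slot and all other identifiers elsewhere, so it is no longer looked up through [r']. *)
Lemma bump_compat : compat t (bump_ty E (r u)) r' G L ((u, S0) :: D).
Proof.
  assert (Hc : cont T = S0) by (destruct HT as [->| ->]; easy).
  destruct (compat_ix _ _ _ _ _ _ HC u) as (i & Ei).
  assert (TY : bump_ty E (r u) = set_ty E (next (r u)) (CSes S0))
    by (unfold bump_ty; now rewrite bump_E, Hc).
  assert (OLD : forall v, v <> u -> r' v = r v)
    by (intros v Hv; apply bump_id_neq; [apply HC|assumption]).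
  assert (NEW : r' u = next (r u)) by (eapply bump_id_eq, bump_E).
  assert (OLDT : forall v, v <> u -> bump_ty E (r u) (r v) = E (r v)).
  { intros v Hv. rewrite TY, Ei, next_ix. apply set_ty_ix; [apply HC|assumption]. }
  split.
  - apply bump_id_ix, HC.
  - intros v S [[= <- <-]|Hv].
    + rewrite NEW, TY. apply set_ty_eq.
    + rewrite OLD, OLDT by (eapply bump_fresh; eassumption).
      eapply compat_ses; [exact HC|now right].
  - intros v S [[= <- <-]|Hv].
    + right. rewrite NEW, Ei, next_ix, index_ix. lia.
    + rewrite OLD by (eapply bump_fresh; eassumption).
      eapply compat_pos; [exact HC|now right].
  - intros v V Hv.
    rewrite OLD, OLDT by (eapply bump_fresh_chan; eassumption).
    eapply compat_shr; [exact HC|assumption].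
  - apply HC.
Qed.

Lemma bump_chans : chans r' G = chans r G.
Proof.
  apply chans_ext. intros v V Hv. apply bump_id_neq; [apply HC|].
  eapply bump_fresh_chan; eassumption.
Qed.

(* A channel whose type is consumed down to [SEnd] loses its last slot. *)
Lemma bump_live :
  live r ((u, T) :: D) =
  (r u, match T with SIn _ _ => MIn [GU U] | _ => MOut [GU U] end)
  :: live r' ((u, S0) :: D).
Proof.
  assert (E' : live r' D = live r D).
  { apply live_ext. intros v S Hv. apply bump_id_neq; [apply HC|].
    eapply bump_fresh; eassumption. }
  assert (NEW : r' u = next (r u)) by (eapply bump_id_eq, bump_E).
  pose proof bump_pos as Hi.
  destruct (compat_ix _ _ _ _ _ _ HC u) as (i & Ei).
  rewrite !live_cons, E', NEW, Ei, next_ix, index_ix. rewrite Ei, index_ix in Hi.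
  (* Since the old index is positive, the new one exceeds 1. For [S0 = SEnd] the advanced name is
     then exhausted, just as [GS T] has a single element. *)
  destruct i as [|i]; [lia|].
  destruct HT as [-> | ->]; destruct S0; simpl; rewrite ?next_ix, ?index_ix; reflexivity.
Qed.

End Bump.

(** Weaker than [ann_ok]: Abs always concludes with a linear type, so an abstraction annotated [Shr]
    violates [ann_ok] in the premise of Prom. Constraining only linear annotations is stable under
    that rule. *)
Definition lin_use (V : val) (U : utype) : Prop :=
  match V with Abs Lin _ _ _ => exists C, U = Fun Lin C | _ => True end.

Lemma ann_lin_use V U : ann_ok V U -> lin_use V U.
Proof. destruct V as [x|[] x C P]; simpl; eauto. Qed.

(** Unlike for processes, both endpoints of [c_k] may be present, because an abstraction contains
    the output that triggers its own body. Only a linear abstraction exposes its propagators, which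
    explains the length [degV V]. *)
Definition val_ok G L D V U : Prop :=
  forall t E r k, compat t E r G L D -> lin_use V U -> no_exhausted_argV E r V ->
  exists Us, length Us = degV V /\
    mhas_val (ctx_env t (hofvV V) ++ chans r G) [] (pg_env k Us ++ live r D)
      (BV E r k (hofvV V) V) (GU U).

(* A breakdown has no free higher-order variable: it receives them through its
   first propagator. *)
Definition proc_ok G L D P : Prop :=
  forall t E r k, compat t E r G L D -> no_exhausted_arg E r P ->
  exists Us, S (length Us) = deg P /\
    mhas_proc (chans r G) []
      ((pg_in k, MIn (ctx_types t (hofv P))) :: pg_env (S k) Us ++ live r D)
      (B E r k (hofv P) P).

Lemma mann_ok_BV E r k xs V U : ann_ok V U -> mann_ok (BV E r k xs V) (GU U).
Proof.
  destruct V as [x|m x C P]; simpl; [easy|]. intros ->.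
  simpl. rewrite map_snd_combine; [easy|]. now rewrite length_map, length_seq.
Qed.

Lemma ho_wf G L D P :
  has_proc G L D P -> forall x, In x (hofv P) -> exists C, ho_in G L x C.
Proof. intros H. eapply (proj2 hofv_typed); eassumption. Qed.

Lemma ho_wf_val G L D V U :
  has_val G L D V U -> forall x, In x (hofvV V) -> exists C, ho_in G L x C.
Proof. intros H. eapply (proj1 hofv_typed); eassumption. Qed.

Lemma sess_args G u i Ms :
  mwf G [] (combine (slots (ix u i) (length Ms)) Ms) ->
  mhas_chans G (combine (slots (ix u i) (length Ms)) Ms)
    (slots (ix u i) (length Ms)) (map MCSes Ms).
Proof.
  revert i. induction Ms as [|M Ms IH]; simpl; intros i HW.
  - now apply M_ChansNil.
  - rewrite next_ix in *.
    apply (@M_ChansCons G [(ix u i, M)]).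
    + apply M_Sess. mwf_from HW.
    + apply IH. mwf_from HW.
    + exact HW.
Qed.

(** The condition on the index excludes the one mismatch between [args] and [live]: an exhausted
    name, for which [args] mentions a slot that [live] does not provide. *)
Lemma args_ok t E r G L D D2 u C Gt :
  compat t E r G L D -> incl D2 D -> has_chan G D2 u C ->
  (E (r u) = Some (CSes SEnd) -> index (r u) <= 1) ->
  incl (chans r G) Gt -> mwf Gt [] (live r D2) ->
  mhas_chans Gt (live r D2) (args E (r u)) (GC C).
Proof.
  intros HC HD Hu Hend HG HW. unfold args.
  destruct Hu as [G u S HWu|G u U _ HU].
  - rewrite (compat_ses _ _ _ _ _ _ HC u S) in * by (apply HD; now left).
    rewrite live_cons in *. simpl in HW |- *. rewrite app_nil_r in *.
    destruct (compat_ix _ _ _ _ _ _ HC u) as (i & Ei).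
    assert (X : exhausted (index (r u)) S = false).
    { destruct S; simpl; auto. apply Nat.ltb_ge. now apply Hend. }
    rewrite X in *. rewrite length_map, Ei in *. now apply sess_args.
  - rewrite (compat_shr _ _ _ _ _ _ HC u U) by assumption. simpl.
    apply (@M_ChansCons Gt [] []); [|now apply M_ChansNil|assumption].
    apply M_Sh; [assumption|]. apply HG. now apply in_chans_intro.
Qed.

(** * Preservation of the invariant by the source rules *)

Lemma case_LVar G x C : wf G [(x, C)] [] -> val_ok G [(x, C)] [] (Var x) (Fun Lin C).
Proof.
  intros HW t E r k HC _ _. exists []. split; [easy|]. simpl.
  rewrite (compat_ho _ _ _ _ _ _ HC x C) by (right; now left).
  apply M_EPromV, M_LVar.
  assert (W := target_wf t r _ _ _ [x] 0 [] (compat_ix _ _ _ _ _ _ HC) HW).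
  simpl in W. specialize (W ltac:(repeat constructor; easy)).
  unfold mwf in *. simpl in *.
  apply Permutation_NoDup with (l := TVar (VIx x 0) :: map mgkey (chans r G) ++ []).
  - perm.
  - assert (W' := W ltac:(intros y [<-|[]]; exists C; right; now left)).
    now inversion W'.
Qed.

(** [lin_use] at a shared type rules out a linear annotation. The degree is then 0, no propagator is
    exposed, and the session environment is empty as Prom requires. *)
Lemma case_Prom G V C :
  has_val G [] [] V (Fun Lin C) ->
  val_ok G [] [] V (Fun Lin C) -> val_ok G [] [] V (Fun Shr C).
Proof.
  intros _ IH t E r k HC HL HN.
  assert (D0 : degV V = 0).
  { destruct V as [x|[] x C' P]; simpl in *; try easy. now destruct HL. }
  destruct (IH t E r k HC) as (Us & HU & HV); [|assumption|].
  { destruct V as [x|[] x C' P]; simpl in *; eauto. }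
  rewrite D0 in HU. apply length_zero_iff_nil in HU as ->.
  exists []. split; [now symmetry|]. now apply M_Prom.
Qed.

Lemma case_StructV G G' L L' D D' V U :
  has_val G L D V U -> val_ok G L D V U ->
  incl G G' -> Permutation L L' -> Permutation D D' -> wf G' L' D' ->
  val_ok G' L' D' V U.
Proof.
  intros HV IH HG HL HD HW t E r k HC HLin HN.
  destruct (IH t E r k) as (Us & HU & HV'); [|assumption|assumption|].
  { eapply compat_sub; [exact HC|auto| |].
    - intros x C [Hx|Hx]; [left; auto|right]. eapply Permutation_in; eassumption.
    - intros e. apply Permutation_in. now symmetry. }
  exists Us. split; [assumption|].
  assert (W := target_wf t r _ _ _ (hofvV V) k Us (compat_ix _ _ _ _ _ _ HC) HW
    (proj1 NoDup_hofv V)).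
  eapply val_struct; [exact HV'| | |].
  - apply incl_app_app; [apply incl_refl|now apply chans_incl].
  - apply Permutation_app_head. now apply live_perm.
  - eassert (W' : mwf _ _ _).
    { apply W. intros x Hx. destruct (ho_wf_val _ _ _ _ _ HV x Hx) as (C & [H|H]);
        exists C; [left; auto|right]. eapply Permutation_in; eassumption. }
    mwf_from W'.
Qed.

Lemma case_Struct G G' L L' D D' P :
  has_proc G L D P -> proc_ok G L D P ->
  incl G G' -> Permutation L L' -> Permutation D D' -> wf G' L' D' ->
  proc_ok G' L' D' P.
Proof.
  intros HV IH HG HL HD HW t E r k HC HN.
  destruct (IH t E r k) as (Us & HU & HV'); [|assumption|].
  { eapply compat_sub; [exact HC|auto| |].
    - intros x C [Hx|Hx]; [left; auto|right]. eapply Permutation_in; eassumption.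
    - intros e. apply Permutation_in. now symmetry. }
  exists Us. split; [assumption|].
  eassert (W : mwf _ _ _) by
   (apply (target_wf t r _ _ _ [] k (ctx_types t (hofv P) :: Us)
     (compat_ix _ _ _ _ _ _ HC) HW (NoDup_nil _)); easy).
  eapply proc_struct; [exact HV'| | |].
  - now apply chans_incl.
  - constructor. apply Permutation_app_head. now apply live_perm.
  - simpl in W. mwf_from W.
Qed.

(** The target judgement is literally the same: [chans] ignores function entries and [ho_in] does
    not distinguish the two environments. *)
Lemma case_EPromV G L D x C V U :
  val_ok G ((x, C) :: L) D V U -> val_ok (GFun x C :: G) L D V U.
Proof.
  intros IH t E r k HC. apply (IH t E r k).
  eapply compat_sub; [exact HC| | |apply incl_refl].
  - now right.
  - intros y C' [H|[[= -> ->]|H]]; [left; now right|left; now left|now right].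
Qed.

Lemma case_EProm G L D x C P :
  proc_ok G ((x, C) :: L) D P -> proc_ok (GFun x C :: G) L D P.
Proof.
  intros IH t E r k HC. apply (IH t E r k).
  eapply compat_sub; [exact HC| | |apply incl_refl].
  - now right.
  - intros y C' [H|[[= -> ->]|H]]; [left; now right|left; now left|now right].
Qed.

Lemma case_Nil G : wf G [] [] -> proc_ok G [] [] Nil.
Proof.
  intros HW t E r k HC _. exists []. split; [easy|]. simpl.
  eassert (W : mwf _ _ _) by
   (apply (target_wf t r _ _ _ [] k [[]] (compat_ix _ _ _ _ _ _ HC) HW
      (NoDup_nil _)); easy).
  apply (@c_in_ok t (chans r G) [] k [] MNil); simpl in *.
  - mwf_from W.
  - apply (@mnil_ok _ [pg_in k]). simpl. mwf_from W.
Qed.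

Lemma case_End G L D u P :
  has_proc G L D P -> proc_ok G L D P -> wf G L ((u, SEnd) :: D) ->
  proc_ok G L ((u, SEnd) :: D) P.
Proof.
  intros HP IH HW t E r k HC HN.
  destruct (IH t E r k) as (Us & HU & HP'); [|assumption|].
  { eapply compat_sub; [exact HC|auto|auto|apply incl_tl, incl_refl]. }
  exists Us. split; [assumption|].
  eassert (W : mwf _ _ _) by
   (apply (target_wf t r _ _ _ [] k (ctx_types t (hofv P) :: Us)
     (compat_ix _ _ _ _ _ _ HC) HW (NoDup_nil _)); easy).
  rewrite live_cons in *. simpl in *.
  (* An exhausted name adds no entry; otherwise it adds one slot of type [MEnd], introduced by End
     in the target. *)
  destruct (1 <? index (r u)); simpl in *; [exact HP'|].
  eapply proc_struct; [|apply incl_refl| |].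
  - apply M_End with (u := r u); [exact HP'|]. mwf_from W.
  - perm.
  - mwf_from W.
Qed.

Lemma case_App G L D1 D2 V u m C :
  has_val G L D1 V (Fun m C) -> val_ok G L D1 V (Fun m C) ->
  ann_ok V (Fun m C) -> has_chan G D2 u C -> wf G L (D1 ++ D2) ->
  proc_ok G L (D1 ++ D2) (App V u).
Proof.
  intros HV IH HA Hu HW t E r k HC [HN1 HN2].
  destruct (IH t E r (k + 1)) as (Us & HU & HV'); [|now apply ann_lin_use|assumption|].
  { eapply compat_sub; [exact HC|auto|auto|apply incl_appl, incl_refl]. }
  exists Us. split; [simpl; lia|].
  eassert (W : mwf _ _ _) by
   (apply (target_wf t r _ _ _ (hofvV V) k (ctx_types t (hofvV V) :: Us)
     (compat_ix _ _ _ _ _ _ HC) HW (proj1 NoDup_hofv V)), (ho_wf_val _ _ _ _ _ HV)).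
  simpl in *. rewrite Nat.add_1_r in *. rewrite live_app in *.
  apply c_in_ok with (t := t); [mwf_from W|].
  eapply proc_struct with
    (D := (pg_in k, MEnd) :: ((pg_env (S k) Us ++ live r D1) ++ live r D2));
    [|apply incl_refl|perm|mwf_from W].
  (* The used propagator [c_k] has type end and an application has no continuation to hold it, so
     End introduces it here. *)
  apply M_End; [|mwf_from W].
  apply M_App with (m := m) (Cs := GC C).
  - exact HV'.
  - exact (mann_ok_BV E r (S k) (hofvV V) V (Fun m C) HA).
  - eapply args_ok; try eassumption.
    + apply incl_appr, incl_refl.
    + apply incl_appr, incl_refl.
    + mwf_from W.
  - mwf_from W.
Qed.

Lemma one_val G D V U :
  mhas_val G [] D V U -> mwf G [] D -> mhas_vals G [] D [V] [U].
Proof.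
  intros HV HW. rewrite <- (app_nil_r D).
  apply (@M_ValsCons G [] [] D []); [assumption| |rewrite !app_nil_r; exact HW].
  apply M_ValsNil. mwf_from HW.
Qed.

(** The rest of the session on [u] may be owned by the continuation or by the value sent. Both are
    therefore broken down with the advanced renaming, and the splitting of the premise is
    transported through [live]. *)
Lemma case_Send G L1 L2 D D1 D2 u T U V P :
  Permutation (D1 ++ D2) ((u, T) :: D) ->
  has_proc G L1 D1 P -> proc_ok G L1 D1 P ->
  has_val G L2 D2 V U -> val_ok G L2 D2 V U -> ann_ok V U ->
  wf G (L1 ++ L2) ((u, SOut U T) :: D) ->
  proc_ok G (L1 ++ L2) ((u, SOut U T) :: D) (Send u V P).
Proof.
  intros HD HP IHP HV IHV HA HW t E r k HC [HN1 HN2].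
  assert (HT : is_prefix_of U T (SOut U T)) by now left.
  pose proof (bump_compat _ _ _ _ _ _ _ _ _ _ HC HW HT) as HC'.
  pose proof (bump_chans _ _ _ _ _ _ _ _ HC HW) as CH.
  pose proof (bump_live _ _ _ _ _ _ _ _ _ _ HC HW HT) as LV.
  set (E' := bump_ty E (r u)) in *. set (r' := bump_id E (r u) r) in *.
  assert (HDi : incl (D1 ++ D2) ((u, T) :: D)) by (intros e; now apply Permutation_in).
  destruct (IHP t E' r' (S (k + degV V))) as (Us2 & HU2 & HP'); [|assumption|].
  { eapply compat_sub; [exact HC'|auto| |].
    - intros x C [H|H]; [now left|right]. now apply in_app_iff; left.
    - intros e He. apply HDi, in_app_iff. now left. }
  destruct (IHV t E' r' (S k)) as (Us1 & HU1 & HV');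
    [|now apply ann_lin_use|assumption|].
  { eapply compat_sub; [exact HC'|auto| |].
    - intros x C [H|H]; [now left|right]. now apply in_app_iff; right.
    - intros e He. apply HDi, in_app_iff. now right. }
  (* The propagators exposed by [V], then the one that triggers the continuation, at index
     [k + degV V + 1], then the remaining ones of the continuation. *)
  exists (Us1 ++ ctx_types t (hofv P) :: Us2).
  split; [rewrite length_app; simpl; lia|].
  pose proof (live_perm r' _ _ HD) as HD'. rewrite live_app in HD'.
  rewrite CH in HP', HV'. rewrite LV.
  change (B E r k (hofv (Send u V P)) (Send u V P)) with
    (MPar (c_in k (hofv (Send u V P))
            (MSend (r u) [BV E' r' (k + 1) (hofvV V) V]
               (c_out (k + degV V + 1) (hofv P) MNil)))
          (B E' r' (k + degV V + 1) (hofv P) P)).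
  rewrite !Nat.add_1_r, pg_env_app. rewrite <- HU1 in *. simpl pg_env.
  assert (I1 : incl (hofvV V) (hofv (Send u V P)))
    by (intros x Hx; apply nodup_In, in_app_iff; now left).
  assert (I2 : incl (hofv P) (hofv (Send u V P)))
    by (intros x Hx; apply nodup_In, in_app_iff; now right).
  set (xs := hofv (Send u V P)) in *. set (K := S (k + length Us1)) in *.
  (* The largest environment of this case, with [VUnit], the whole context and both endpoints of
     every propagator. *)
  assert (W : mwf (GFun VUnit [MCSes MEnd] :: ctx_env t xs ++ chans r G) []
     ((pg_in k, MIn (ctx_types t xs)) :: (pg_out k, MOut (ctx_types t xs))
      :: pg_env (S k) Us1
      ++ (pg_in K, MIn (ctx_types t (hofv P))) :: (pg_out K, MOut (ctx_types t (hofv P)))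
      :: pg_env (S K) Us2 ++ (r u, MOut [GU U]) :: live r' D1 ++ live r' D2)).
  { eapply mwf_perm; cycle 1.
    - eapply (target_wf t r _ _ _ xs k
        (ctx_types t xs :: Us1 ++ ctx_types t (hofv P) :: Us2)
        (compat_ix _ _ _ _ _ _ HC) HW (proj2 NoDup_hofv _)).
      intros x Hx. apply nodup_In, in_app_iff in Hx as [Hx|Hx].
      + destruct (ho_wf_val _ _ _ _ _ HV x Hx) as (C & [H|H]); exists C;
          [now left|right; apply in_app_iff; now right].
      + destruct (ho_wf _ _ _ _ HP x Hx) as (C & [H|H]); exists C;
          [now left|right; apply in_app_iff; now left].
    - rewrite LV, <- HD'. simpl. rewrite pg_env_app. simpl. perm. }
  clearbody xs.
  apply par_ok with
    (D1 := (pg_in k, MIn (ctx_types t xs)) :: (r u, MOut [GU U])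
       :: (pg_out K, MOut (ctx_types t (hofv P))) :: pg_env (S k) Us1 ++ live r' D2)
    (D2 := (pg_in K, MIn (ctx_types t (hofv P))) :: pg_env (S K) Us2 ++ live r' D1).
  - apply c_in_ok; [mwf_from W|].
    apply send_ok with (Us := [GU U])
      (D1 := [(pg_in k, MEnd); (pg_out K, MOut (ctx_types t (hofv P)))])
      (D2 := pg_env (S k) Us1 ++ live r' D2).
    + eapply proc_struct with
        (D := (pg_out K, MOut (ctx_types t (hofv P))) :: [(r u, MEnd); (pg_in k, MEnd)]);
        [|apply incl_refl|perm|mwf_from W].
      apply c_out_ok; [mwf_from W|now apply incl_appl, ctx_env_incl|].
      apply (@mnil_ok _ [pg_out K; r u; pg_in k]). simpl. mwf_from W.
    + apply one_val; [|mwf_from W].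
      eapply val_struct; [exact HV'| |reflexivity|mwf_from W].
      apply incl_app_app; [now apply ctx_env_incl|apply incl_refl].
    + constructor; [|constructor]. now apply mann_ok_BV.
    + perm.
    + mwf_from W.
  - exact HP'.
  - rewrite <- HD'. perm.
  (* Counting cannot relate the slots of [(u, T) :: D] to those of [D1] and [D2]; the permutation
     [HD'] has to be rewritten first. *)
  - assert (W' : mwf (chans r G) []
      ((pg_in k, MIn (ctx_types t xs)) :: pg_env (S k) Us1
      ++ (pg_in K, MIn (ctx_types t (hofv P))) :: (pg_out K, MOut (ctx_types t (hofv P)))
      :: pg_env (S K) Us2 ++ (r u, MOut [GU U]) :: live r' D1 ++ live r' D2))
      by mwf_from W.
    eapply mwf_perm; [|exact W']. rewrite <- HD'. perm.
Qed.

Lemma bump_shr t E r G L D u U :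
  compat t E r G L D -> In (GChan u U) G ->
  bump_ty E (r u) = E /\ bump_id E (r u) r = r.
Proof.
  intros HC Hu. pose proof (compat_shr _ _ _ _ _ _ HC u U Hu) as HE.
  unfold bump_ty, bump_id. now rewrite HE.
Qed.

Lemma case_Req G L D1 D2 u U V P :
  has_chan G [] u (CShr U) ->
  has_proc G L D1 P -> proc_ok G L D1 P ->
  has_val G [] D2 V U -> val_ok G [] D2 V U -> ann_ok V U ->
  wf G L (D1 ++ D2) ->
  proc_ok G L (D1 ++ D2) (Send u V P).
Proof.
  intros Hu HP IHP HV IHV HA HW t E r k HC HN.
  assert (Hu' : In (GChan u U) G) by now inversion Hu.
  destruct (bump_shr _ _ _ _ _ _ _ _ HC Hu') as (BT & BI).
  simpl in HN. rewrite BT, BI in HN. destruct HN as [HN1 HN2].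
  destruct (IHP t E r (S (k + degV V))) as (Us2 & HU2 & HP'); [|assumption|].
  { eapply compat_sub; [exact HC|auto|auto|apply incl_appl, incl_refl]. }
  destruct (IHV t E r (S k)) as (Us1 & HU1 & HV'); [|now apply ann_lin_use|assumption|].
  { eapply compat_sub; [exact HC|auto| |apply incl_appr, incl_refl].
    intros x C [H|[]]. now left. }
  exists (Us1 ++ ctx_types t (hofv P) :: Us2).
  split; [rewrite length_app; simpl; lia|].
  assert (EB : B E r k (hofv (Send u V P)) (Send u V P) =
    MPar (c_in k (hofv (Send u V P))
            (MSend (r u) [BV E r (k + 1) (hofvV V) V]
               (c_out (k + degV V + 1) (hofv P) MNil)))
          (B E r (k + degV V + 1) (hofv P) P)) by (simpl; now rewrite BT, BI).
  rewrite EB, !Nat.add_1_r, pg_env_app, live_app. rewrite <- HU1 in *. simpl pg_env.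
  assert (I1 : incl (hofvV V) (hofv (Send u V P)))
    by (intros x Hx; apply nodup_In, in_app_iff; now left).
  assert (I2 : incl (hofv P) (hofv (Send u V P)))
    by (intros x Hx; apply nodup_In, in_app_iff; now right).
  set (xs := hofv (Send u V P)) in *. set (K := S (k + length Us1)) in *.
  assert (W : mwf (GFun VUnit [MCSes MEnd] :: ctx_env t xs ++ chans r G) []
     ((pg_in k, MIn (ctx_types t xs)) :: (pg_out k, MOut (ctx_types t xs))
      :: pg_env (S k) Us1
      ++ (pg_in K, MIn (ctx_types t (hofv P))) :: (pg_out K, MOut (ctx_types t (hofv P)))
      :: pg_env (S K) Us2 ++ live r D1 ++ live r D2)).
  { eapply mwf_perm; cycle 1.
    - eapply (target_wf t r _ _ _ xs k
        (ctx_types t xs :: Us1 ++ ctx_types t (hofv P) :: Us2)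
        (compat_ix _ _ _ _ _ _ HC) HW (proj2 NoDup_hofv _)).
      intros x Hx. apply nodup_In, in_app_iff in Hx as [Hx|Hx].
      + destruct (ho_wf_val _ _ _ _ _ HV x Hx) as (C & [H|[]]); exists C. now left.
      + exact (ho_wf _ _ _ _ HP x Hx).
    - rewrite live_app. simpl. rewrite pg_env_app. simpl. perm. }
  clearbody xs.
  apply par_ok with
    (D1 := (pg_in k, MIn (ctx_types t xs))
       :: (pg_out K, MOut (ctx_types t (hofv P))) :: pg_env (S k) Us1 ++ live r D2)
    (D2 := (pg_in K, MIn (ctx_types t (hofv P))) :: pg_env (S K) Us2 ++ live r D1).
  - apply c_in_ok; [mwf_from W|].
    eapply proc_struct with
      (D := [(pg_out K, MOut (ctx_types t (hofv P))); (pg_in k, MEnd)]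
            ++ (pg_env (S k) Us1 ++ live r D2));
      [|apply incl_refl|perm|mwf_from W].
    apply M_Req with (U := GU U).
    + apply M_Sh; [mwf_from W|]. apply in_app_iff. right. now apply in_chans_intro.
    + apply c_out_ok; [mwf_from W|now apply incl_appl, ctx_env_incl|].
      apply (@mnil_ok _ [pg_out K; pg_in k]). simpl. mwf_from W.
    + eapply val_struct; [exact HV'| |reflexivity|mwf_from W].
      apply incl_app_app; [now apply ctx_env_incl|apply incl_refl].
    + now apply mann_ok_BV.
    + mwf_from W.
  - exact HP'.
  - perm.
  - mwf_from W.
Qed.

Lemma case_Par G L1 L2 D1 D2 P Q :
  has_proc G L1 D1 P -> proc_ok G L1 D1 P ->
  has_proc G L2 D2 Q -> proc_ok G L2 D2 Q ->
  wf G (L1 ++ L2) (D1 ++ D2) ->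
  proc_ok G (L1 ++ L2) (D1 ++ D2) (Par P Q).
Proof.
  intros HP IHP HQ IHQ HW t E r k HC [HN1 HN2].
  destruct (IHP t E r (S k)) as (Us1 & HU1 & HP'); [|assumption|].
  { eapply compat_sub; [exact HC|auto| |apply incl_appl, incl_refl].
    intros x C [H|H]; [now left|right]. now apply in_app_iff; left. }
  destruct (IHQ t E r (S (k + deg P))) as (Us2 & HU2 & HQ'); [|assumption|].
  { eapply compat_sub; [exact HC|auto| |apply incl_appr, incl_refl].
    intros x C [H|H]; [now left|right]. now apply in_app_iff; right. }
  (* The first group has length [deg P], so the second starts at [k + deg P + 1], the trigger of
     [Q]. *)
  exists ((ctx_types t (hofv P) :: Us1) ++ ctx_types t (hofv Q) :: Us2).
  split; [rewrite length_app; simpl; lia|].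
  change (B E r k (hofv (Par P Q)) (Par P Q)) with
    (MPar (c_in k (hofv (Par P Q))
             (c_out (k + 1) (hofv P) (c_out (k + deg P + 1) (hofv Q) MNil)))
       (MPar (B E r (k + 1) (hofv P) P) (B E r (k + deg P + 1) (hofv Q) Q))).
  rewrite !Nat.add_1_r, pg_env_app, live_app. simpl length. rewrite <- HU1 in *.
  replace (S k + S (length Us1)) with (S (k + S (length Us1))) by lia.
  simpl pg_env.
  assert (I1 : incl (hofv P) (hofv (Par P Q)))
    by (intros x Hx; apply nodup_In, in_app_iff; now left).
  assert (I2 : incl (hofv Q) (hofv (Par P Q)))
    by (intros x Hx; apply nodup_In, in_app_iff; now right).
  set (xs := hofv (Par P Q)) in *. set (K := S (k + S (length Us1))) in *.
  assert (W : mwf (GFun VUnit [MCSes MEnd] :: ctx_env t xs ++ chans r G) []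
     ((pg_in k, MIn (ctx_types t xs)) :: (pg_out k, MOut (ctx_types t xs))
      :: (pg_in (S k), MIn (ctx_types t (hofv P)))
      :: (pg_out (S k), MOut (ctx_types t (hofv P))) :: pg_env (S (S k)) Us1
      ++ (pg_in K, MIn (ctx_types t (hofv Q))) :: (pg_out K, MOut (ctx_types t (hofv Q)))
      :: pg_env (S K) Us2 ++ live r D1 ++ live r D2)).
  { eapply mwf_perm; cycle 1.
    - eapply (target_wf t r _ _ _ xs k
        (ctx_types t xs :: ctx_types t (hofv P) :: Us1 ++ ctx_types t (hofv Q) :: Us2)
        (compat_ix _ _ _ _ _ _ HC) HW (proj2 NoDup_hofv _)).
      intros x Hx. apply nodup_In, in_app_iff in Hx as [Hx|Hx].
      + destruct (ho_wf _ _ _ _ HP x Hx) as (C & [H|H]); exists C;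
          [now left|right; apply in_app_iff; now left].
      + destruct (ho_wf _ _ _ _ HQ x Hx) as (C & [H|H]); exists C;
          [now left|right; apply in_app_iff; now right].
    - rewrite live_app. simpl. rewrite pg_env_app. simpl.
      replace (S (S (k + length Us1))) with K by (unfold K; lia). perm. }
  clearbody xs.
  assert (W0 : mwf (chans r G) []
     ((pg_in (S k), MIn (ctx_types t (hofv P))) :: (pg_in K, MIn (ctx_types t (hofv Q)))
      :: pg_env (S (S k)) Us1 ++ pg_env (S K) Us2 ++ live r D1 ++ live r D2))
    by mwf_from W.
  apply par_ok with
    (D1 := [(pg_in k, MIn (ctx_types t xs)); (pg_out (S k), MOut (ctx_types t (hofv P)));
            (pg_out K, MOut (ctx_types t (hofv Q)))])
    (D2 := (pg_in (S k), MIn (ctx_types t (hofv P))) :: (pg_in K, MIn (ctx_types t (hofv Q)))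
       :: pg_env (S (S k)) Us1 ++ pg_env (S K) Us2 ++ live r D1 ++ live r D2).
  - apply c_in_ok; [mwf_from W|].
    eapply proc_struct with
      (D := [(pg_out (S k), MOut (ctx_types t (hofv P)));
             (pg_out K, MOut (ctx_types t (hofv Q))); (pg_in k, MEnd)]);
      [|apply incl_refl|perm|mwf_from W].
    apply c_out_ok; [mwf_from W|now apply incl_appl, ctx_env_incl|].
    eapply proc_struct with
      (D := [(pg_out K, MOut (ctx_types t (hofv Q))); (pg_out (S k), MEnd); (pg_in k, MEnd)]);
      [|apply incl_refl|perm|mwf_from W].
    apply c_out_ok; [mwf_from W|now apply incl_appl, ctx_env_incl|].
    apply (@mnil_ok _ [pg_out K; pg_out (S k); pg_in k]). simpl. mwf_from W.
  - eapply par_ok; [exact HP'|exact HQ'|perm|exact W0].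
  - perm.
  - mwf_from W.
Qed.

(** Well-formedness of the premise keeps [IShr a] out of [G] and [D], even if the raw term reuses
    [a]; hence declared names keep their image and their type. *)
Lemma case_Res G L D a U P :
  has_proc (GChan (IShr a) U :: G) L D P -> proc_ok (GChan (IShr a) U :: G) L D P ->
  proc_ok G L D (ResShr a U P).
Proof.
  intros HP IH t E r k HC HN. simpl in HN.
  pose proof (proc_wf _ _ _ _ HP) as HW. apply wf_entries in HW as (W1 & _ & _ & _ & W5 & _).
  set (r' := set_id r (IShr a) (TShr a 1)) in *.
  set (E' := set_ty E (TShr a 1) (CShr U)) in *.
  assert (OLD : forall v, v <> IShr a -> r' v = r v) by (intros; now apply set_id_neq).
  assert (OLDT : forall v, v <> IShr a -> E' (r v) = E (r v))
    by (intros; apply (set_ty_ix E r (IShr a) 1); [apply HC|assumption]).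
  assert (FC : forall v V, In (GChan v V) G -> v <> IShr a).
  { intros v V Hv ->. inversion_clear W1 as [|? ? N _]. apply N.
    now apply (in_map gkey) in Hv. }
  assert (FD : forall v T, In (v, T) D -> v <> IShr a).
  { intros v T Hv ->. eapply W5; [now left|exact Hv|reflexivity]. }
  destruct (IH t E' r' k) as (Us & HU & HP'); [|assumption|].
  { split.
    - apply (set_id_ix r (IShr a) 1), HC.
    - intros v T Hv. rewrite OLD, OLDT by (eapply FD; eassumption).
      eapply compat_ses; eassumption.
    - intros v T Hv. rewrite OLD by (eapply FD; eassumption).
      eapply compat_pos; eassumption.
    - intros v V [[= <- <-]|Hv].
      + unfold r'. rewrite set_id_eq. apply set_ty_eq.
      + rewrite OLD, OLDT by (eapply FC; eassumption).
        eapply compat_shr; eassumption.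
    - intros x C [[[=]|H]|H]; (eapply compat_ho; [exact HC|]); [now left|now right]. }
  exists Us. split; [assumption|].
  apply (@M_Res (chans r G) [] _ a 1 (GU U) (B E' r' k (hofv P) P)).
  replace (live r D) with (live r' D) by (apply live_ext; intros; apply OLD; eauto).
  replace (chans r G) with (chans r' G) by (apply chans_ext; intros; apply OLD; eauto).
  unfold chans in *. simpl in HP'. unfold r' in HP' at 1.
  rewrite set_id_eq in HP'. exact HP'.
Qed.

Lemma case_ResS G L D s S1 P :
  has_proc G L ((ISes s false, S1) :: (ISes s true, dual S1) :: D) P ->
  proc_ok G L ((ISes s false, S1) :: (ISes s true, dual S1) :: D) P ->
  proc_ok G L D (ResSes s S1 P).
Proof.
  intros HP IH t E r k HC HN. simpl in HN.
  pose proof (proc_wf _ _ _ _ HP) as HW.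
  pose proof HW as HW'. apply wf_entries in HW' as (_ & _ & W3 & _ & W5 & _).
  set (r1 := set_id r (ISes s false) (TSes (SIx s 1) false)) in *.
  set (r' := set_id r1 (ISes s true) (TSes (SIx s 1) true)) in *.
  set (E1 := set_ty E (TSes (SIx s 1) false) (CSes S1)) in *.
  set (E' := set_ty E1 (TSes (SIx s 1) true) (CSes (dual S1))) in *.
  assert (IX1 : indexing r1) by apply (set_id_ix r (ISes s false) 1), HC.
  assert (IX : indexing r') by now apply (set_id_ix r1 (ISes s true) 1).
  set (fresh v := v <> ISes s false /\ v <> ISes s true).
  assert (OLD : forall v, fresh v -> r' v = r v).
  { intros v [H1 H2]. unfold r'. rewrite set_id_neq by assumption.
    now apply set_id_neq. }
  assert (OLDT : forall v, fresh v -> E' (r v) = E (r v)).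
  { intros v [H1 H2]. unfold E'.
    rewrite (set_ty_ix E1 r (ISes s true) 1 v) by (assumption || apply HC).
    apply (set_ty_ix E r (ISes s false) 1 v); [apply HC|assumption]. }
  assert (R0 : r' (ISes s false) = ix (ISes s false) 1).
  { unfold r'. rewrite set_id_neq by discriminate. apply set_id_eq. }
  assert (R1 : r' (ISes s true) = ix (ISes s true) 1) by apply set_id_eq.
  assert (FC : forall v V, In (GChan v V) G -> fresh v).
  { intros v V Hv; split; intros ->.
    - eapply W5; [exact Hv|now left|reflexivity].
    - eapply W5; [exact Hv|now right; left|reflexivity]. }
  assert (FD : forall v T, In (v, T) D -> fresh v).
  { simpl in W3. inversion_clear W3 as [|? ? N1 W3'].
    inversion_clear W3' as [|? ? N2 _].
    intros v T Hv; apply (in_map fst) in Hv; split; intros ->; simpl in *; tauto. }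
  destruct (IH t E' r' k) as (Us & HU & HP'); [|assumption|].
  { split.
    - exact IX.
    - intros v T [[= <- <-]|[[= <- <-]|Hv]].
      + rewrite R0. unfold E'. simpl. unfold set_ty at 1.
        destruct tident_eq_dec; [discriminate|]. apply set_ty_eq.
      + rewrite R1. apply set_ty_eq.
      + rewrite OLD, OLDT by (eapply FD; eassumption).
        eapply compat_ses; eassumption.
    - intros v T [[= <- <-]|[[= <- <-]|Hv]].
      + right. now rewrite R0.
      + right. now rewrite R1.
      + rewrite OLD by (eapply FD; eassumption). eapply compat_pos; eassumption.
    - intros v V Hv. rewrite OLD, OLDT by (eapply FC; eassumption).
      eapply compat_shr; eassumption.
    - apply HC. }
  exists Us. split; [assumption|].
  replace (live r D) with (live r' D) by (apply live_ext; intros; apply OLD; eauto).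
  replace (chans r G) with (chans r' G) by (apply chans_ext; intros; apply OLD; eauto).
  (* Restricted names start at index 1, so both endpoints own all their slots, even at type end. *)
  assert (X : forall T co, exhausted (index (ix (ISes s co) 1)) T = false)
    by now intros [|U T|U T].
  eassert (W : mwf _ _ _) by
   (apply (target_wf t r' _ _ _ [] k (ctx_types t (hofv P) :: Us) IX HW (NoDup_nil _)); easy).
  rewrite !live_cons, R0, R1, !X, GS_dual, length_map in W, HP'. simpl in W.
  change (mhas_proc (chans r' G) []
    ((pg_in k, MIn (ctx_types t (hofv P))) :: pg_env (S k) Us ++ live r' D)
    (s_res s 1 (GS S1) (B E' r' k (hofv P) P))).
  apply s_res_ok.
  - eapply proc_struct; [exact HP'|apply incl_refl|perm|simpl; mwf_from W].
  - simpl. mwf_from W.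
Qed.

(** * Variables bound by an input *)

Lemma chans_gminus r G x :
  (forall U, ~ In (GChan (IVar x) U) G) -> chans r (gminus G x) = chans r G.
Proof.
  unfold chans. induction G as [|g G IH]; simpl; intros H; [easy|].
  destruct (ident_eq_dec (gkey g) (IVar x)) as [E|_]; simpl.
  - destruct g as [y C|u U]; simpl in *; [|subst u; now destruct (H U); left].
    apply IH. intros U HU. apply (H U). now right.
  - rewrite IH; [easy|]. intros U HU. apply (H U). now right.
Qed.

(** Raw terms allow shadowing, so [t] may hold an unrelated type at the bound variable and has to be
    overwritten there. *)
Definition set_var (t : nat -> ctype) (x : nat) (C : ctype) : nat -> ctype :=
  fun z => if Nat.eq_dec z x then C else t z.

Section Receive.
Context (t : nat -> ctype) (E : tyinfo) (r : ident -> tident)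
  (G : genv) (L L2 : lenv) (D : senv) (x : nat) (m : mode) (C : ctype).
Context (HC : compat t E r (gminus G x) L D).
Context (HW : wf G (L ++ L2) D).
Context (HV : has_val G L2 [] (Var x) (Fun m C)).

Lemma recv_ho : ho_in G L2 x C /\ (forall y C', In (y, C') L2 -> y = x).
Proof.
  apply var_typing in HV as (_ & m' & C' & [= <- <-] & H1 & H2). now split.
Qed.

Lemma recv_no_chan v V : In (GChan v V) G -> v <> IVar x.
Proof.
  intros Hv ->. pose proof HW as HW'.
  apply wf_entries in HW' as (W1 & _ & _ & W4 & _).
  destruct recv_ho as ([H|H] & _).
  - assert (e : GFun x C = GChan (IVar x) V :> gentry ident nat ctype utype)
      by (eapply NoDup_map_inj; eauto).
    discriminate e.
  - eapply (W4 _ Hv); [apply in_app_iff; right; exact H|reflexivity].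
Qed.

Lemma recv_no_ses v S : In (v, S) D -> v <> IVar x.
Proof.
  intros Hv ->. pose proof HW as HW'.
  apply wf_entries in HW' as (_ & _ & _ & _ & W5 & W6).
  destruct recv_ho as ([H|H] & _).
  - eapply W5; [exact H|exact Hv|reflexivity].
  - eapply W6; [apply in_app_iff; right; exact H|exact Hv].
Qed.

Lemma recv_type y C' : ho_in G (L ++ L2) y C' -> set_var t x C y = C'.
Proof.
  unfold set_var. pose proof HW as HW'.
  apply wf_entries in HW' as (W1 & W2 & _ & W4 & _).
  destruct recv_ho as (H1 & H2). intros H.
  assert (KL : forall z A A', In (z, A) (L ++ L2) -> In (z, A') (L ++ L2) -> A = A').
  { intros z A A' HA HA'.
    assert (e : (z, A) = (z, A')) by (eapply NoDup_map_inj; [exact W2|..]; auto).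
    congruence. }
  destruct (Nat.eq_dec y x) as [->|Hn].
  - assert (H1' : ho_in G (L ++ L2) x C).
    { destruct H1; [now left|right]. apply in_app_iff. now right. }
    destruct H as [H|H], H1' as [H1'|H1'].
    + assert (e : GFun x C = GFun x C' :> gentry ident nat ctype utype)
        by (eapply NoDup_map_inj; eauto).
      congruence.
    + now destruct (W4 _ H _ _ H1').
    + now destruct (W4 _ H1' _ _ H).
    + eapply KL; eassumption.
  - eapply compat_ho; [exact HC|]. destruct H as [H|H].
    + left. apply in_gminus. split; [assumption|simpl; congruence].
    + right. apply in_app_iff in H as [H|H]; [assumption|].
      apply H2 in H. congruence.
Qed.

Let r' := set_id r (IVar x) (ix (IVar x) 0).

Lemma recv_compat : compat (set_var t x C) E r' G (L ++ L2) D.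
Proof.
  assert (OLD : forall v, v <> IVar x -> r' v = r v)
    by (intros; now apply set_id_neq).
  split.
  - apply set_id_ix, HC.
  - intros v S Hv. rewrite OLD by (eapply recv_no_ses; eassumption).
    eapply compat_ses; eassumption.
  - intros v S Hv. rewrite OLD by (eapply recv_no_ses; eassumption).
    eapply compat_pos; eassumption.
  - intros v V Hv. pose proof (recv_no_chan v V Hv) as Hn. rewrite OLD by assumption.
    eapply compat_shr; [exact HC|]. apply in_gminus. now split.
  - exact recv_type.
Qed.

Lemma recv_chans : chans r' G = chans r (gminus G x).
Proof.
  rewrite chans_gminus.
  - apply chans_ext. intros v V Hv. apply set_id_neq. eapply recv_no_chan; eassumption.
  - intros U HU. now apply recv_no_chan in HU.
Qed.

Lemma recv_live : live r' D = live r D.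
Proof.
  apply live_ext. intros v S Hv. apply set_id_neq. eapply recv_no_ses; eassumption.
Qed.

Lemma recv_ctx P :
  incl (ctx_env (set_var t x C) (hofv P))
    (GFun (VIx x 0) (GC C) :: ctx_env t (remove Nat.eq_dec x (hofv P))).
Proof.
  intros g Hg. apply in_map_iff in Hg as (z & <- & Hz). unfold set_var.
  destruct (Nat.eq_dec z x) as [->|Hn]; [now left|right].
  apply ctx_env_entry; [|easy]. now apply in_in_remove.
Qed.

Lemma recv_wf P k Us :
  (forall y, In y (hofv P) -> exists C', ho_in G (L ++ L2) y C') ->
  mwf (GFun VUnit [MCSes MEnd] :: GFun (VIx x 0) (GC C)
       :: ctx_env t (remove Nat.eq_dec x (hofv P)) ++ chans r (gminus G x)) []
    (pg_env k Us ++ live r D).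
Proof.
  intros HO.
  eassert (W : mwf _ _ _).
  (* The environments of the premise still declare [x], so its key comes out distinct from all the
     others; [x] is listed even if it does not occur in [P]. *)
  { apply (target_wf t r G (L ++ L2) D (x :: remove Nat.eq_dec x (hofv P)) k Us).
    - apply HC.
    - exact HW.
    - constructor; [apply remove_In|apply NoDup_nat_remove, NoDup_hofv].
    - intros y [<-|Hy].
      + exists C. destruct recv_ho as ([H|H] & _); [now left|right].
        apply in_app_iff. now right.
      + apply HO. now apply in_remove in Hy. }
  rewrite chans_gminus; [exact W|].
  intros U HU. now apply recv_no_chan in HU.
Qed.

End Receive.

Lemma case_Rcv G L L2 D u T U x P :
  has_proc G (L ++ L2) ((u, T) :: D) P -> proc_ok G (L ++ L2) ((u, T) :: D) P ->
  has_val G L2 [] (Var x) U ->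
  proc_ok (gminus G x) L ((u, SIn U T) :: D) (Recv u x P).
Proof.
  intros HP IH HV t E r k HC HN.
  assert (HWc : wf (gminus G x) L ((u, SIn U T) :: D))
    by (eapply proc_wf, T_Rcv; eassumption).
  pose proof (proc_wf _ _ _ _ HP) as HW.
  assert (HW1 : wf G (L ++ L2) ((u, SIn U T) :: D)) by exact HW.
  destruct (var_typing _ _ _ _ _ HV) as (_ & m & C & -> & _).
  assert (HT : is_prefix_of (Fun m C) T (SIn (Fun m C) T)) by now right.
  (* As in [B], the name is advanced first, in the environments of the conclusion, and the renaming
     is then reset at [x]. *)
  pose proof (bump_compat _ _ _ _ _ _ _ _ _ _ HC HWc HT) as HC1.
  pose proof (bump_chans _ _ _ _ _ _ _ _ HC HWc) as CH.
  pose proof (bump_live _ _ _ _ _ _ _ _ _ _ HC HWc HT) as LV.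
  simpl in HN.
  pose proof (recv_compat _ _ _ _ _ _ _ _ _ _ HC1 HW HV) as HC'.
  pose proof (recv_chans (bump_id E (r u) r) _ _ _ _ _ _ _ HW HV) as CH'.
  pose proof (recv_live (bump_id E (r u) r) _ _ _ _ _ _ _ HW HV) as LV'.
  set (E' := bump_ty E (r u)) in *. set (r1 := bump_id E (r u) r) in *.
  destruct (IH _ E' _ (S k) HC' HN) as (Us & HU & HP').
  rewrite CH', LV', CH in HP'. rewrite LV.
  (* The new propagator forwards the context of the continuation, which may contain the variable
     just received. *)
  exists (ctx_types (set_var t x C) (hofv P) :: Us). split; [simpl; lia|].
  assert (W := recv_wf _ _ _ _ _ _ _ _ _ _ HC HW1 HV P k
    (ctx_types t (remove Nat.eq_dec x (hofv P))
      :: ctx_types (set_var t x C) (hofv P) :: Us) (ho_wf _ _ _ _ HP)).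
  rewrite LV in W. simpl in W |- *. rewrite Nat.add_1_r.
  pose proof (recv_ctx t x C P) as HI.
  set (xs := remove Nat.eq_dec x (hofv P)) in *.
  set (Z := ctx_types (set_var t x C) (hofv P)) in *.
  apply par_ok with
    (D1 := [(pg_in k, MIn (ctx_types t xs)); (r u, MIn [MFun m (GC C)]);
            (pg_out (S k), MOut Z)])
    (D2 := (pg_in (S k), MIn Z) :: pg_env (S (S k)) Us ++ live r1 ((u, T) :: D)).
  - apply c_in_ok; [mwf_from W|].
    eapply proc_struct with
      (D := (r u, MIn [MFun m (GC C)]) :: [(pg_out (S k), MOut Z); (pg_in k, MEnd)]);
      [|apply incl_refl|perm|mwf_from W].
    apply (@recv_shared _ _ _ [(VIx x 0, m, GC C)]); simpl; [mwf_from W|].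
    eapply proc_struct with
      (D := (pg_out (S k), MOut Z) :: [(r u, MEnd); (pg_in k, MEnd)]);
      [|apply incl_refl|perm|mwf_from W].
    apply c_out_ok; [mwf_from W| |].
    + intros g Hg. destruct (HI g Hg) as [<-|Hg']; [now left|right].
      apply in_app_iff. now left.
    + apply (@mnil_ok _ [pg_out (S k); r u; pg_in k]). simpl. mwf_from W.
  - exact HP'.
  - perm.
  - mwf_from W.
Qed.

Lemma case_Acc G L L2 D u U x P :
  has_chan G [] u (CShr U) ->
  has_proc G (L ++ L2) D P -> proc_ok G (L ++ L2) D P ->
  has_val G L2 [] (Var x) U ->
  proc_ok (gminus G x) L D (Recv u x P).
Proof.
  intros Hu HP IH HV t E r k HC HN.
  pose proof (proc_wf _ _ _ _ HP) as HW.
  destruct (var_typing _ _ _ _ _ HV) as (_ & m & C & -> & _).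
  assert (Hu' : In (GChan u (Fun m C)) (gminus G x)).
  { assert (H : In (GChan u (Fun m C)) G) by now inversion Hu.
    apply in_gminus. split; [assumption|].
    exact (recv_no_chan _ _ _ _ _ _ _ HW HV _ _ H). }
  destruct (bump_shr _ _ _ _ _ _ _ _ HC Hu') as (BT & BI).
  simpl in HN. rewrite BT, BI in HN.
  pose proof (recv_compat _ _ _ _ _ _ _ _ _ _ HC HW HV) as HC'.
  pose proof (recv_chans r _ _ _ _ _ _ _ HW HV) as CH'.
  pose proof (recv_live r _ _ _ _ _ _ _ HW HV) as LV'.
  destruct (IH _ E _ (S k) HC' HN) as (Us & HU & HP').
  rewrite CH', LV' in HP'.
  exists (ctx_types (set_var t x C) (hofv P) :: Us). split; [simpl; lia|].
  assert (W := recv_wf _ _ _ _ _ _ _ _ _ _ HC HW HV P k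
    (ctx_types t (remove Nat.eq_dec x (hofv P))
      :: ctx_types (set_var t x C) (hofv P) :: Us) (ho_wf _ _ _ _ HP)).
  simpl in W |- *. rewrite BT, BI, Nat.add_1_r.
  pose proof (recv_ctx t x C P) as HI.
  set (xs := remove Nat.eq_dec x (hofv P)) in *.
  set (Z := ctx_types (set_var t x C) (hofv P)) in *.
  apply par_ok with
    (D1 := [(pg_in k, MIn (ctx_types t xs)); (pg_out (S k), MOut Z)])
    (D2 := (pg_in (S k), MIn Z) :: pg_env (S (S k)) Us ++ live r D).
  - apply c_in_ok; [mwf_from W|].
    apply accept_shared with (m := m) (Cs := GC C).
    + apply in_app_iff. right. exact (in_chans_intro r _ _ _ Hu').
    + mwf_from W.
    + eapply proc_struct with
        (D := (pg_out (S k), MOut Z) :: [(pg_in k, MEnd)]);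
        [|apply incl_refl|perm|mwf_from W].
      apply c_out_ok; [mwf_from W| |].
      * intros g Hg. destruct (HI g Hg) as [<-|Hg']; [now left|right].
        apply in_app_iff. now left.
      * apply (@mnil_ok _ [pg_out (S k); pg_in k]). simpl. mwf_from W.
  - exact HP'.
  - perm.
  - mwf_from W.
Qed.

(** * Channel variables bound by an abstraction *)

Section Abstraction.
Context (t : nat -> ctype) (E : tyinfo) (r : ident -> tident)
  (G : genv) (L : lenv) (D D2 : senv) (y : nat) (C : ctype).
Context (HC : compat t E r (gminus G y) L D).
Context (HW : wf G L (D ++ D2)).
Context (Hy : has_chan G D2 (IVar y) C).

Lemma abs_ses v S : In (v, S) D2 -> v = IVar y /\ C = CSes S.
Proof. inversion Hy; subst; [intros [[= <- <-]|[]]|]; easy. Qed.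

Lemma abs_no_ses v S : In (v, S) D -> v <> IVar y.
Proof.
  intros Hv ->. pose proof HW as HW'.
  apply wf_entries in HW' as (W1 & _ & W3 & _ & W5 & _).
  inversion Hy as [G0 u T _|G0 u U _ HU]; subst.
  - rewrite map_app, NoDup_app_iff in W3. destruct W3 as (_ & _ & W3).
    apply (W3 (IVar y)); [|now left]. now apply (in_map fst) in Hv.
  - eapply W5; [exact HU|apply in_app_iff; left; exact Hv|reflexivity].
Qed.

(** The parameter of an abstraction is a channel, so it never belongs to a context, and [hofvV] of
    the abstraction equals [hofv] of its body. *)
Lemma abs_ho x C' : ho_in G L x C' -> x <> y.
Proof.
  intros Hx ->. pose proof HW as HW'.
  apply wf_entries in HW' as (W1 & _ & _ & W4 & W5 & W6).
  inversion Hy as [G0 u T _|G0 u U _ HU]; subst; destruct Hx as [Hx|Hx].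
  - eapply W5; [exact Hx|apply in_app_iff; right; now left|reflexivity].
  - eapply W6; [exact Hx|apply in_app_iff; right; now left].
  - assert (e : GFun y C' = GChan (IVar y) U :> gentry ident nat ctype utype)
      by (eapply NoDup_map_inj; eauto).
    discriminate e.
  - eapply W4; [exact HU|exact Hx|reflexivity].
Qed.

Lemma abs_chan U : In (GChan (IVar y) U) G -> C = CShr U.
Proof.
  intros HU. pose proof HW as HW'.
  apply wf_entries in HW' as (W1 & _ & _ & _ & W5 & _).
  inversion Hy as [G0 u T _|G0 u U' _ HU']; subst.
  - exfalso. eapply W5; [exact HU|apply in_app_iff; right; now left|reflexivity].
  - assert (e : GChan (IVar y) U = GChan (IVar y) U' :> gentry ident nat ctype utype)
      by (eapply NoDup_map_inj; eauto).
    congruence.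
Qed.

Let r' := set_id r (IVar y) (ix (IVar y) 1).

Lemma abs_live : live r' D = live r D.
Proof.
  apply live_ext. intros v S Hv. apply set_id_neq. eapply abs_no_ses; eassumption.
Qed.

(** A shared parameter has a single slot, at index 1: exactly the entry that the binder of the
    target abstraction removes. *)
Lemma abs_chans g :
  In g (chans r' G) ->
  In g (chans r (gminus G y)) \/ (mgkey g = ix (IVar y) 1 /\ length (GC C) = 1).
Proof.
  intros Hg. apply in_flat_map in Hg as ([x A|u U] & Hu & Hg); [easy|].
  destruct Hg as [<-|[]]. destruct (ident_eq_dec u (IVar y)) as [->|Hn].
  - right. apply abs_chan in Hu as ->. split; [|easy]. simpl. apply set_id_eq.
  - left. unfold r'. rewrite set_id_neq by assumption.
    apply in_chans_intro, in_gminus. now split.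
Qed.

Let E' := set_ty E (ix (IVar y) 1) C.

Lemma abs_compat : compat t E' r' G L (D ++ D2).
Proof.
  assert (OLD : forall v, v <> IVar y -> r' v = r v)
    by (intros; now apply set_id_neq).
  assert (OLDT : forall v, v <> IVar y -> E' (r v) = E (r v))
    by (intros; apply set_ty_ix; [apply HC|assumption]).
  assert (NEW : r' (IVar y) = ix (IVar y) 1) by apply set_id_eq.
  assert (NEWT : E' (ix (IVar y) 1) = Some C) by apply set_ty_eq.
  split.
  - apply set_id_ix, HC.
  - intros v S Hv. apply in_app_iff in Hv as [Hv|Hv].
    + rewrite OLD, OLDT by (eapply abs_no_ses; eassumption).
      eapply compat_ses; eassumption.
    + apply abs_ses in Hv as (-> & HC'). now rewrite NEW, NEWT, HC'.
  - intros v S Hv. apply in_app_iff in Hv as [Hv|Hv].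
    + rewrite OLD by (eapply abs_no_ses; eassumption).
      eapply compat_pos; eassumption.
    + apply abs_ses in Hv as (-> & _). right. now rewrite NEW.
  - intros v V Hv. destruct (ident_eq_dec v (IVar y)) as [->|Hn].
    + apply abs_chan in Hv as ->. now rewrite NEW, NEWT.
    + rewrite OLD, OLDT by assumption. eapply compat_shr; [exact HC|].
      apply in_gminus. now split.
  - intros x C' Hx. eapply compat_ho; [exact HC|].
    pose proof (abs_ho _ _ Hx) as Hn. destruct Hx as [Hx|Hx]; [left|now right].
    apply in_gminus. split; [assumption|simpl; congruence].
Qed.

End Abstraction.

Lemma abs_vars y n (Cs : list mctype) :
  length Cs = n ->
  map (fun e => TVar (fst e)) (combine (map (VIx y) (seq 1 n)) Cs)
  = slots (ix (IVar y) 1) n.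
Proof.
  intros Hn. rewrite slots_ix, <- (map_map fst TVar), map_fst_combine, map_map.
  - easy.
  - now rewrite length_map, length_seq.
Qed.

Lemma case_Abs G L D D2 m y C P :
  has_proc G L (D ++ D2) P -> proc_ok G L (D ++ D2) P ->
  has_chan G D2 (IVar y) C ->
  val_ok (gminus G y) L D (Abs m y C P) (Fun Lin C).
Proof.
  intros HP IH Hy t E r k HC _ HN. simpl in HN.
  pose proof (proc_wf _ _ _ _ HP) as HW.
  assert (HWc : wf (gminus G y) L D)
    by (eapply val_wf, (@T_Abs G L D D2 m); eassumption).
  pose proof (abs_compat _ _ _ _ _ _ _ _ _ HC HW Hy) as HC'.
  pose proof (abs_live r _ _ _ _ _ _ HW Hy) as LV.
  pose proof (abs_chans r _ _ _ _ _ _ HW Hy) as CH.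
  assert (HO : forall x, In x (hofv P) -> x <> y).
  { intros x Hx. destruct (ho_wf _ _ _ _ HP x Hx) as (A & HA).
    exact (abs_ho _ _ _ _ _ _ HW Hy _ _ HA). }
  assert (Exs : hofvV (Abs m y C P) = hofv P).
  { apply notin_remove. intros H. now apply (HO y). }
  destruct (IH t _ _ k HC' HN) as (Us & HU & HP').
  rewrite Exs. simpl BV. rewrite live_app, LV in HP'.
  assert (W := target_wf t _ _ _ _ (hofv P) k (ctx_types t (hofv P) :: Us)
    (compat_ix _ _ _ _ _ _ HC') HW (proj2 NoDup_hofv P) (ho_wf _ _ _ _ HP)).
  rewrite live_app, LV in W. simpl in W.
  (* The parameter enters at index 1, so the side condition of [args_ok] holds even when its type is
     end. *)
  assert (ARGS : forall Gt,
    incl (chans (set_id r (IVar y) (TVar (VIx y 1))) G) Gt ->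
    mwf Gt [] (live (set_id r (IVar y) (TVar (VIx y 1))) D2) ->
    mhas_chans Gt (live (set_id r (IVar y) (TVar (VIx y 1))) D2)
      (slots (ix (IVar y) 1) (length (GC C))) (GC C)).
  { intros Gt HG HGt.
    assert (A := args_ok _ _ _ _ _ _ D2 (IVar y) C Gt HC'
      (incl_appr _ (incl_refl _)) Hy).
    simpl in A. rewrite set_id_eq in A.
    replace (args _ _) with (slots (TVar (VIx y 1)) (length (GC C))) in A
      by (unfold args; now rewrite set_ty_eq).
    apply A; auto. }
  simpl in *.
  set (r' := set_id r (IVar y) (TVar (VIx y 1))) in *.
  set (E' := set_ty E (TVar (VIx y 1)) C) in *.
  set (xs := hofv P) in *.
  assert (BODY : mhas_proc (ctx_env t xs ++ chans r' G) []
    (pg_env k (ctx_types t xs :: Us) ++ live r D ++ live r' D2)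
    (MPar (c_out k xs MNil) (B E' r' k xs P))).
  { simpl. eapply par_ok with (D1 := [(pg_out k, MOut (ctx_types t xs))]).
    - apply c_out_ok; [mwf_from W|apply incl_appl, incl_refl|].
      apply (@mnil_ok _ [pg_out k]). simpl. mwf_from W.
    - eapply proc_struct; [exact HP'|apply incl_appr, incl_refl|reflexivity|].
      mwf_from W.
    - perm.
    - mwf_from W. }
  (* [Us'] types the propagators left visible: all of them for a linear annotation, none for a
     shared one. This treats both modes together. *)
  assert (LAM : forall Us',
    mhas_proc (ctx_env t xs ++ chans r' G) []
      ((pg_env k Us' ++ live r D) ++ live r' D2)
      (c_res k (match m with Lin => 0 | Shr => deg P end)
        (MPar (c_out k xs MNil) (B E' r' k xs P))) ->
    mwf (ctx_env t xs ++ chans r' G) [] ((pg_env k Us' ++ live r D) ++ live r' D2) ->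
    mhas_val (ctx_env t xs ++ chans r (gminus G y)) [] (pg_env k Us' ++ live r D)
      (MAbs m (combine (map (VIx y) (seq 1 (length (GC C)))) (GC C))
        (c_res k (match m with Lin => 0 | Shr => deg P end)
          (MPar (c_out k xs MNil) (B E' r' k xs P))))
      (MFun Lin (GC C))).
  { intros Us' HB HWU.
    set (ys := combine (map (VIx y) (seq 1 (length (GC C)))) (GC C)).
    assert (LEN : length (map (VIx y) (seq 1 (length (GC C)))) = length (GC C))
      by now rewrite length_map, length_seq.
    replace (MFun Lin (GC C)) with (MFun Lin (map snd ys))
      by (unfold ys; now rewrite map_snd_combine).
    eapply val_struct.
    - eapply M_Abs; [|exact HB|].
      + unfold ys. rewrite map_fst_combine by assumption.
        apply FinFun.Injective_map_NoDup; [now intros ? ? [=]|apply seq_NoDup].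
      + unfold ys. rewrite abs_vars, map_snd_combine by auto.
        apply ARGS; [apply incl_appr, incl_refl|mwf_from W].
    - intros g Hg. apply filter_In in Hg as (Hg & Hk).
      apply in_app_iff in Hg as [Hg|Hg]; apply in_app_iff; [now left|right].
      destruct (CH g Hg) as [Hg'|(Hg' & HL)]; [assumption|exfalso].
      destruct in_dec as [|Hn]; [easy|]. apply Hn. rewrite Hg'.
      unfold ys. rewrite map_fst_combine, HL by assumption. now left.
    - reflexivity.
    (* The outer environment uses the old renaming and lacks the parameter, so it is not a part of
       the one described by [W]. *)
    - eassert (W2 : mwf _ _ _) by
        (apply (target_wf t r _ _ _ xs k Us' (compat_ix _ _ _ _ _ _ HC) HWc
          (proj2 NoDup_hofv P)); intros x Hx;
         destruct (ho_wf _ _ _ _ HP x Hx) as (A & [HA|HA]); exists A;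
         [left; apply in_gminus; split; [assumption|]; simpl;
          intros [= ->]; now apply (HO y)|now right]).
      mwf_from W2. }
  destruct m.
  - exists (ctx_types t xs :: Us). split; [assumption|].
    apply LAM; simpl.
    + eapply proc_struct; [exact BODY|apply incl_refl|simpl; perm|mwf_from W].
    + mwf_from W.
  - exists []. split; [easy|]. apply LAM.
    + replace (deg P) with (length (ctx_types t xs :: Us)) by exact HU.
      apply c_res_ok; [exact BODY|simpl; mwf_from W].
    + simpl. mwf_from W.
Qed.

Lemma breakdown_ok :
  (forall G L D V U, has_val G L D V U -> val_ok G L D V U) /\
  (forall G L D P, has_proc G L D P -> proc_ok G L D P).
Proof.
  apply typing_ind.
  - exact case_LVar.
  - exact case_Prom.
  - intros. now apply case_EPromV.
  - intros. eapply case_Abs; eassumption.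
  - intros. eapply case_StructV; eassumption.
  - exact case_Nil.
  - intros. now apply case_EProm.
  - intros. eapply case_App; eassumption.
  - intros. eapply case_Send; eassumption.
  - intros. eapply case_Rcv; eassumption.
  - intros. eapply case_Req; eassumption.
  - intros. eapply case_Acc; eassumption.
  - intros. eapply case_Par; eassumption.
  - intros. now apply case_End.
  - intros. now apply case_Res.
  - intros. subst. now apply case_ResS.
  - intros. eapply case_Struct; eassumption.
Qed.

(** * Closed processes *)

Lemma hofv_free :
  (forall V x, In x (hofvV V) -> In (IVar x) (freeV V)) /\
  (forall P x, In x (hofv P) -> In (IVar x) (free P)).
Proof.
  assert (RM : forall v x l, In (IVar x) l -> v <> IVar x ->
    In (IVar x) (remove ident_eq_dec v l))
    by (intros; apply in_in_remove; congruence).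
  apply val_proc_ind; simpl; intros; try easy.
  - apply nodup_In, in_app_iff in H1 as [H1|H1]; right; apply in_app_iff; auto.
  - apply in_remove in H0 as [H0 Hn]. right. apply RM; [auto|congruence].
  - apply in_app_iff. auto.
  - apply nodup_In, in_app_iff in H1 as [H1|H1]; apply in_app_iff; auto.
  - apply RM; [auto|discriminate].
  - apply RM; [apply RM; [auto|discriminate]|discriminate].
  - left. now destruct H as [->|[]].
  - apply in_remove in H0 as [H0 Hn]. apply RM; [auto|congruence].
Qed.

Lemma closed_hofv P : closed P -> hofv P = [].
Proof.
  intros H. destruct (hofv P) as [|x xs] eqn:Ex; [easy|].
  exfalso. apply (H x). apply (proj2 hofv_free). rewrite Ex. now left.
Qed.

Lemma init_ix P : indexing (init P).
Proof. intros u. unfold init. destruct in_dec; eauto. Qed.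

Lemma init_index P u : index (init P u) <= 1.
Proof. unfold init. destruct in_dec; rewrite index_ix; auto. Qed.

(** Closedness excludes variables, which [fn] filters out and [init] would leave at index 0. *)
Lemma init_free P u : closed P -> In u (free P) -> index (init P u) = 1.
Proof.
  intros Hcl Hu. unfold init. destruct in_dec as [_|Hn]; [apply index_ix|].
  exfalso. apply Hn. apply filter_In. split; [assumption|].
  destruct u; try easy. now apply Hcl in Hu.
Qed.

(** The initial assignment [t], read off [G]; the default for undeclared variables is arbitrary. *)
Definition ho_type (G : genv) (x : nat) : ctype :=
  match find (fun g => match g with GFun y _ => Nat.eqb y x | _ => false end) G with
  | Some (GFun _ C) => C
  | _ => CSes SEnd
  end.

Lemma ho_type_eq G x C :
  NoDup (map gkey G) -> In (GFun x C) G -> ho_type G x = C.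
Proof.
  intros HN Hx. unfold ho_type.
  destruct find as [g|] eqn:F.
  - apply find_some in F as (Hg & E). destruct g as [y A|u U]; [|easy].
    apply Nat.eqb_eq in E as ->.
    assert (e : GFun x A = GFun x C :> gentry ident nat ctype utype)
      by (eapply NoDup_map_inj; eauto).
    congruence.
  - apply find_none with (x := GFun x C) in F; [|assumption].
    now rewrite Nat.eqb_refl in F.
Qed.

(** The lookup could only go wrong by finding another entry with the same indexed name; injectivity
    of [r] and uniqueness of keys exclude it. *)
Lemma info_chan r G D u U :
  indexing r -> NoDup (map gkey G) -> In (GChan u U) G ->
  info (subst_genv r G) (subst_senv r D) (r u) = Some (CShr U).
Proof.
  intros Hr HN Hu. unfold info.
  destruct find as [g|] eqn:F.
  - apply find_some in F as (Hg & E). destruct g as [y A|v V]; [easy|].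
    destruct tident_eq_dec as [->|]; [|easy].
    apply in_map_iff in Hg as ([y A|w V'] & E' & Hw); [easy|].
    injection E' as E' ->. apply indexing_inj in E' as ->; [|assumption].
    assert (e : GChan u V = GChan u U :> gentry ident nat ctype utype)
      by (eapply NoDup_map_inj; eauto).
    congruence.
  - exfalso. apply find_none with (x := GChan (r u) U) in F.
    + now destruct tident_eq_dec.
    + apply in_map_iff. now exists (GChan u U).
Qed.

Lemma info_ses r G D u S :
  indexing r -> NoDup (map fst D) ->
  (forall U, ~ In (GChan u U) G) -> In (u, S) D ->
  info (subst_genv r G) (subst_senv r D) (r u) = Some (CSes S).
Proof.
  intros Hr HN HG Hu. unfold info.
  assert (FD : forall X : option ctype,
    match find (fun e => if tident_eq_dec (fst e) (r u) then true else false)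
        (subst_senv r D) with
    | Some (_, T) => Some (CSes T)
    | None => X
    end = Some (CSes S)).
  { intros X. destruct (find _ (subst_senv r D)) as [(v & T)|] eqn:F.
    - apply find_some in F as (Hv & E). simpl in E.
      destruct tident_eq_dec as [->|]; [|easy].
      apply in_map_iff in Hv as ((w & T') & E' & Hw).
      injection E' as E' ->. apply indexing_inj in E' as ->; [|assumption].
      assert (e : (u, T) = (u, S)) by (eapply NoDup_map_inj; eauto).
      congruence.
    - exfalso. apply find_none with (x := (r u, S)) in F.
      + simpl in F. now destruct tident_eq_dec.
      + apply in_map_iff. now exists (u, S). }
  destruct (find _ (subst_genv r G)) as [[y A|v V]|] eqn:F; auto.
  exfalso. apply find_some in F as (Hv & E).
  destruct tident_eq_dec as [->|]; [|easy].
  apply in_map_iff in Hv as ([y A|w V'] & E' & Hw); [easy|].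
  injection E' as E' ->. apply indexing_inj in E' as ->; [|assumption].
  exact (HG _ Hw).
Qed.

(** Initial indices never exceed 1, so no name is exhausted and [live] coincides with the
    decomposition of the environment. *)
Lemma Gsenv_live P D : Gsenv (subst_senv (init P) D) = live (init P) D.
Proof.
  induction D as [|(u & S) D IH]; [easy|].
  rewrite live_cons, <- IH. simpl. f_equal.
  pose proof (init_index P u) as Hi.
  destruct S; simpl; try easy.
  destruct (Nat.ltb_spec 1 (index (init P u))); [lia|easy].
Qed.

Lemma chans_Ggenv r G : incl (chans r G) (Ggenv (subst_genv r G)).
Proof.
  intros g Hg. apply in_flat_map in Hg as ([x C|u U] & Hu & Hg); [easy|].
  destruct Hg as [<-|[]]. unfold Ggenv, subst_genv. rewrite map_map.
  apply in_map_iff. now exists (GChan u U).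
Qed.

(** Up to a permutation, the keys are those of a context listing all function entries followed by
    the channels, so [target_wf] applies. The types chosen by [t] do not affect keys. *)
Lemma Ggenv_wf (t : nat -> ctype) r G D :
  indexing r -> wf G [] D -> mwf (Ggenv (subst_genv r G)) [] (live r D).
Proof.
  intros Hr HW. pose proof HW as HW'. apply wf_entries in HW' as (W1 & _).
  set (xs := flat_map (fun g : gentry ident nat ctype utype =>
                         match g with GFun x _ => [x] | GChan _ _ => [] end) G).
  assert (HX : forall x, In x xs -> exists C, In (GFun x C) G).
  { intros x Hx. apply in_flat_map in Hx as ([y C|u U] & Hy & Hx); [|easy].
    destruct Hx as [->|[]]. now exists C. }
  assert (HN : NoDup xs).
  { clear - W1. subst xs. induction G as [|g G IH]; simpl; [constructor|].
    simpl in W1. inversion_clear W1 as [|? ? N1 N2].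
    destruct g as [x C|u U]; simpl; [|auto]. constructor; [|auto].
    intros Hx. apply in_flat_map in Hx as ([y A|u U] & Hy & Hx); [|easy].
    destruct Hx as [->|[]]. apply N1. now apply (in_map gkey) in Hy. }
  assert (PK : Permutation (map mgkey (Ggenv (subst_genv r G)))
    (map mgkey (ctx_env t xs ++ chans r G))).
  { clear. subst xs. unfold Ggenv, subst_genv, ctx_env, chans.
    induction G as [|g G IH]; simpl; [easy|]. destruct g as [x C|u U]; simpl.
    - now constructor.
    - rewrite IH, !map_app. simpl. apply Permutation_middle. }
  pose proof (target_wf t r G [] D xs 0 [] Hr HW HN) as W.
  unfold mwf in *. simpl in *. rewrite PK.
  assert (W' : forall x, In x xs -> exists C, ho_in G [] x C).
  { intros x Hx. destruct (HX x Hx) as (C & H). exists C. now left. }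
  specialize (W W'). now inversion W.
Qed.

Theorem theorem3p11 (P : proc) (G : genv) (D : senv) (k : nat)
  (Hclosed : closed P)
  (Hk : 0 < k)
  (Htyp : has_proc G [] D P)
  (Hend : no_exhausted_arg
            (info (subst_genv (init P) G) (subst_senv (init P) D)) (init P) P) :
  mhas_proc (Ggenv (subst_genv (init P) G)) []
            (Gsenv (subst_senv (init P) D))
            (decompose (info (subst_genv (init P) G) (subst_senv (init P) D)) k P).
Proof.
  pose proof (proc_wf _ _ _ _ Htyp) as HW.
  pose proof HW as HW'. apply wf_entries in HW' as (W1 & _ & W3 & _ & W5 & _).
  pose proof (init_ix P) as Hr.
  set (E := info _ _) in *.
  assert (HC : compat (ho_type G) E (init P) G [] D).
  { split.
    - exact Hr.
    - intros u S Hu. apply info_ses; try assumption.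
      intros U HU. exact (W5 _ HU _ _ Hu eq_refl).
    (* A name of [D] absent from [P] keeps index 0 under [init], but then its type is [SEnd]. *)
    - intros u S Hu. destruct (proj2 session_free _ _ _ _ Htyp _ _ Hu) as [H|H].
      + now left.
      + right. now rewrite init_free.
    - intros u U Hu. now apply info_chan.
    - intros x C [Hx|[]]. now apply ho_type_eq. }
  destruct (proj2 breakdown_ok _ _ _ _ Htyp _ _ _ k HC Hend) as (Us & HU & HP).
  rewrite (closed_hofv P Hclosed) in HP. simpl in HP.
  eassert (W : mwf _ _ _) by
    (apply (target_wf (ho_type G) (init P) G [] D [] k
      (ctx_types (ho_type G) [] :: Us) Hr HW (NoDup_nil _)); easy).
  simpl in W. rewrite Gsenv_live.
  (* The decomposition of a closed process uses no higher-order variable of [G]; these entries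
     return by weakening. *)
  apply proc_struct with (G := chans (init P) G) (D := live (init P) D);
    [|apply chans_Ggenv|reflexivity|now apply (Ggenv_wf (ho_type G))].
  unfold decompose. rewrite <- HU.
  (* The initial trigger [c_k] carries the unit abstraction, the context being empty, and is
     restricted with the other propagators. *)
  change (S (length Us)) with (length (ctx_types (ho_type G) [] :: Us)).
  apply c_res_ok; [|simpl; mwf_from W].
  apply par_ok with
    (D1 := [(pg_out k, MOut (ctx_types (ho_type G) []))])
    (D2 := (pg_in k, MIn (ctx_types (ho_type G) [])) :: pg_env (S k) Us ++ live (init P) D).
  - apply c_out_ok; [mwf_from W|easy|].
    apply (@mnil_ok _ [pg_out k]). simpl. mwf_from W.
  - exact HP.
  - simpl. perm.
  - simpl. mwf_from W.
Qed.
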